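(* Let $\mathcal A=\{A_1,\dots,A_m\}$ be an irreducible finite family of real $d\times d$ matrices, let $\mathcal A^*=\{A_1^T,\dots,A_m^T\}$ be the transpose family, and let $\Pi^*$ be a candidate product of matrices from $\mathcal A^*$. If Algorithm 1 (described in the context) applied to $\mathcal A^*$ and $\Pi^*$ terminates after the $k$th iteration, with final body $G_k^*$, then it produces a Barabanov norm $f$ for the family $\mathcal A$, as follows. Let $\lambda$ be the leading eigenvalue of $\Pi^*$. (i) If $\lambda$ is real, then $f$ is piecewise-linear and is given by $f(x)=\max_{v^*}|(v^*,x)|$, where $v^*$ runs over the set of vertices of $G_k^*$. This is the unique Barabanov norm for $\mathcal A$ (up to multiplication by a positive constant). (ii) If $\lambda\notin\mathbb R$, then $f$ is piecewise-quadratic and is given by $$f(x)=\max_{i=1,\dots,N}\sqrt{(a_i,x)^2+(b_i,x)^2},$$ where $E_i^*=\Phi_{a_i,b_i}(\Gamma)$, $i=1,\dots,N$, are the ellipses generating $G_k^*$ (so $G_k^*=\mathrm{co}\{E_1^*,\dots,E_N^*\}$). If the argument of $\lambda$ is irrational $\mathrm{mod}\ \pi$, then this is the unique Barabanov norm for $\mathcal A$ (up to multiplication by a positive constant).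
   Context: Family: $\mathcal A=\{A_1,\dots,A_m\}$, $m\ge 1$, is irreducible if the matrices $A_i$ share no common invariant linear subspace other than $\{0\}$ and $\mathbb R^d$. $\mathcal A^n$ is the set of products of $n$ matrices from $\mathcal A$ (repetitions permitted); $|\Pi|$ is the length of a product $\Pi$. $\rho(S)$ is the spectral radius of a matrix; $\rho(\mathcal A)=\lim_{n\to\infty}\max_{\Pi\in\mathcal A^n}\|\Pi\|^{1/n}$ is the joint spectral radius; $\nu(\Pi)=\rho(\Pi)^{1/|\Pi|}$. A Barabanov norm of $\mathcal A$ is a norm $f$ on $\mathbb R^d$ with $\max_{i}f(A_ix)=\rho(\mathcal A)f(x)$ for every $x\in\mathbb R^d$. $(\cdot,\cdot)$ is the standard inner product. A leading eigenvalue is an eigenvalue of largest modulus; a leading eigenvector is a corresponding eigenvector. For $\lambda=|\lambda|e^{i\varphi}$ the argument is irrational $\mathrm{mod}\ \pi$ if $\varphi/\pi\notin\mathbb Q$. $\Gamma$ is the unit circle in $\mathbb R^2$; for $x,y\in\mathbb R^d$ and $K\subset\mathbb R^2$, $\Phi_{x,y}(K)=\{s x+t y:(s,t)\in K\}$. Algorithm 1, stated for a finite family $\mathcal B=\{B_1,\dots,B_m\}$ of $d\times d$ matrices (here it is applied with $B_i=A_i^T$). Input: a candidate product $\Pi=B_{s_n}\cdots B_{s_1}$, primitive (not a power of a shorter product), with $\nu(\Pi)>0$. Put $\tilde B_j=\nu(\Pi)^{-1}B_j$, $\tilde{\mathcal B}=\{\tilde B_1,\dots,\tilde B_m\}$,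 $\tilde\Pi=\tilde B_{s_n}\cdots\tilde B_{s_1}$. Let $v$ be the leading eigenvector of $\tilde\Pi$. If the leading eigenvalue is real, $V_1=\{v,-v\}$; if it is non-real and $v=x+iy$ with $x,y\in\mathbb R^d$, then $V_1=\Phi_{x,y}(\Gamma)$. Put $V_j=\tilde B_{s_{j-1}}\cdots\tilde B_{s_1}V_1$, $j=2,\dots,n$. The root is $\mathcal R=\{V_1,\dots,V_n\}$. Zero iteration: $\mathcal V_0=\mathcal H_0=\mathcal R$. $k$th iteration, $k\ge1$: start with $\mathcal V_k=\mathcal V_{k-1}$, $\mathcal H_k=\emptyset$. Go through all pairs $(V,\tilde B)\in\mathcal H_{k-1}\times\tilde{\mathcal B}$ (when $k=1$ the $n$ pairs $(V_j,\tilde B_{s_j})$, $j=1,\dots,n$, are excluded). If $\tilde BV$ lies in the interior of the convex hull of the union of all sets currently in $\mathcal V_k$, skip it; otherwise add the set $\tilde BV$ to both $\mathcal V_k$ and $\mathcal H_k$. When all pairs are exhausted, the body constructed in the $k$th iteration is the convex hull of the union of all sets in $\mathcal V_k$; for $\mathcal B=\mathcal A^*$ it is denoted $G_k^*$. When the leading eigenvalue is non-real, all sets in $\mathcal V_k$ are ellipses of the form $\Phi_{a,b}(\Gamma)$; these are the ellipses generating $G_k^*$. Termination: the algorithm halts after the $k$th iteration when $\mathcal V_k=\mathcal V_{k-1}$, i.e. $\mathcal H_k=\emptyset$. *)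

(* Defs.v *)
(* Vectors of R^d are columns, for an arbitrary R : realType. *)
From mathcomp Require Import all_boot all_order all_algebra.
From mathcomp Require Import all_classical all_reals all_analysis.
From mathcomp Require Import complex.
Set Implicit Arguments.
Unset Strict Implicit.
Unset Printing Implicit Defensive.
Import Order.TTheory GRing.Theory Num.Theory.
Import numFieldNormedType.Exports.
Local Open Scope classical_set_scope.
Local Open Scope ring_scope.

Section Matrices.
Variables (R : realType) (d : nat).
Implicit Types (P : 'M[R]_d) (l : complex R) (x y : 'cV[R]_d).

Definition cplx_mx P : 'M[complex R]_d := map_mx (real_complex R) P.

Definition cplx_col x y : 'cV[complex R]_d := \col_j Complex (x j 0) (y j 0).

(* [eigenvalue] is stated with row eigenvectors; a square matrix has the same
   row and column eigenvalues. *)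
Definition spectral_radius P : R :=
  sup [set Normc.normc l | l in [set l | eigenvalue (cplx_mx P) l]].

Definition leading_eigenvalue P l : Prop :=
  eigenvalue (cplx_mx P) l /\
  forall l', eigenvalue (cplx_mx P) l' -> Normc.normc l' <= Normc.normc l.

Definition irrational_arg l : Prop :=
  exists2 phi : R,
    l = Complex (Normc.normc l * cos phi) (Normc.normc l * sin phi) &
    irrational (phi / pi).

Definition dotp x y : R := \sum_j x j 0 * y j 0.

Definition qform P x : R := dotp x (P *m x).

Definition unit_circle : set (R * R) := [set p | p.1 ^+ 2 + p.2 ^+ 2 = 1].

Definition Phi x y (K : set (R * R)) : set 'cV[R]_d :=
  [set p.1 *: x + p.2 *: y | p in K].

Definition convex_hull (X : set 'cV[R]_d) : set 'cV[R]_d :=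
  smallest (@convex_set R 'cV[R]_d) X.

Definition vertices (G : set 'cV[R]_d) : set 'cV[R]_d :=
  [set v | G v /\ forall x y (t : R), G x -> G y -> 0 < t -> t < 1 ->
                    v = t *: x + (1 - t) *: y -> x = v /\ y = v].

Definition is_max (S : set R) (M : R) : Prop := S M /\ ubound S M.

Definition is_norm (f : 'cV[R]_d -> R) : Prop :=
  [/\ forall x, 0 <= f x,
      forall x, f x = 0 -> x = 0,
      forall (c : R) x, f (c *: x) = `|c| * f x &
      forall x y, f (x + y) <= f x + f y].

(* Finitely many closed polyhedral cones cover R^d, and f is linear on each. *)
Definition piecewise_linear (f : 'cV[R]_d -> R) : Prop :=
  exists pieces : seq (seq 'cV[R]_d * 'cV[R]_d),
    let cone (c : seq 'cV[R]_d) := [set x | {in c, forall a, 0 <= dotp a x}] in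
    (forall x, exists2 p, p \in pieces & cone p.1 x) /\
    (forall p x, p \in pieces -> cone p.1 x -> f x = dotp p.2 x).

(* Finitely many closed sets cut out by quadratic forms cover R^d, and on each
   of them f is the square root of a quadratic form; equivalently, the unit
   sphere of f is made of finitely many pieces of quadrics. *)
Definition piecewise_quadratic (f : 'cV[R]_d -> R) : Prop :=
  exists pieces : seq (seq 'M[R]_d * 'M[R]_d),
    let region (c : seq 'M[R]_d) := [set x | {in c, forall S, 0 <= qform S x}] in
    (forall x, exists2 p, p \in pieces & region p.1 x) /\
    (forall p x, p \in pieces -> region p.1 x ->
       0 <= qform p.2 x /\ f x = Num.sqrt (qform p.2 x)).

End Matrices.

Section Families.
Variables (R : realType) (d m : nat).
Implicit Types (A B : 'I_m -> 'M[R]_d) (s : seq 'I_m).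

Definition transpose_family A : 'I_m -> 'M[R]_d := fun i => (A i)^T.

Definition irreducible_family A : Prop :=
  forall W : {vspace 'cV[R]_d},
    (forall i x, x \in W -> A i *m x \in W) -> W = 0%VS \/ W = fullv.

(* The word [:: s_1; ...; s_n] denotes the product B_{s_n} ... B_{s_1}. *)
Definition word_prod B s : 'M[R]_d := foldl (fun M i => B i *m M) 1%:M s.

Definition primitive_word s : Prop :=
  s <> [::] /\
  ~ exists (u : seq 'I_m) (p : nat), (size u < size s)%N /\ s = flatten (nseq p u).

Definition nu B s : R := spectral_radius (word_prod B s) `^ (size s)%:R^-1.

(* The limit does not depend on the norm; the library's entrywise sup norm on
   matrices is used. *)
Definition jsr A : R :=
  lim ((fun n : nat =>
          (\big[Num.max/0]_(w : n.-tuple 'I_m) `|word_prod A w|) `^ n%:R^-1) @ \oo).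

Definition barabanov A (f : 'cV[R]_d -> R) : Prop :=
  is_norm f /\
  forall x, is_max (range (fun i => f (A i *m x))) (jsr A * f x).

Definition unique_barabanov A (f : 'cV[R]_d -> R) : Prop :=
  forall g, barabanov A g -> exists2 c : R, 0 < c & forall x, g x = c * f x.

Definition apply_set (M : 'M[R]_d) (X : set 'cV[R]_d) : set 'cV[R]_d :=
  [set M *m x | x in X].

Definition normalized B s : 'I_m -> 'M[R]_d := fun i => (nu B s)^-1 *: B i.

(* V_1, for the leading eigenvalue l of the normalized product P. *)
Definition starting_set (P : 'M[R]_d) (l : complex R) (V1 : set 'cV[R]_d) : Prop :=
  leading_eigenvalue P l /\
  if complex.Im l == 0 then
    exists v, [/\ v != 0, P *m v = complex.Re l *: v & V1 = [set v; - v]]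
  else
    exists x y, [/\ cplx_col x y != 0,
      cplx_mx P *m cplx_col x y = l *: cplx_col x y & V1 = Phi x y (@unit_circle R)].

(* Below Bt is the normalized family.  The root, V_k and H_k are indexed
   families of sets, i.e. sequences: the same subset of R^d may occur several
   times, so that exactly n pairs are excluded in the first iteration, and
   V_k = V_{k-1} holds exactly when nothing has been added. *)
Definition root_sets Bt s V1 : seq (set 'cV[R]_d) :=
  [seq apply_set (word_prod Bt (take j s)) V1 | j <- iota 0 (size s)].

Definition body (V : seq (set 'cV[R]_d)) : set 'cV[R]_d :=
  convex_hull (\big[setU/set0]_(X <- V) X).

Definition process_pair Bt (st : seq (set 'cV[R]_d) * seq (set 'cV[R]_d))
    (q : set 'cV[R]_d * 'I_m) :=
  let X := apply_set (Bt q.2) q.1 in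
  if `[< X `<=` interior (body st.1) >] then st
  else (rcons st.1 X, rcons st.2 X).

Definition process Bt V (ps : seq (set 'cV[R]_d * 'I_m)) :=
  foldl (process_pair Bt) (V, [::]) ps.

Definition first_pairs Bt s V1 : seq (set 'cV[R]_d * 'I_m) :=
  [seq (p.1, i) | p <- zip (root_sets Bt s V1) s, i <- [seq i <- enum 'I_m | i != p.2]].

Definition all_pairs (H : seq (set 'cV[R]_d)) : seq (set 'cV[R]_d * 'I_m) :=
  [seq (X, i) | X <- H, i <- enum 'I_m].

(* [algorithm_state Bt s V1 k V H]: some run, going through the pairs of each
   iteration in an arbitrary order and not halting before the k-th iteration,
   reaches V_k = V and H_k = H. *)
Inductive algorithm_state Bt s (V1 : set 'cV[R]_d) :
    nat -> seq (set 'cV[R]_d) -> seq (set 'cV[R]_d) -> Prop :=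
| zero_iteration :
    algorithm_state Bt s V1 0 (root_sets Bt s V1) (root_sets Bt s V1)
| first_iteration ps :
    perm_eq ps (first_pairs Bt s V1) ->
    let st := process Bt (root_sets Bt s V1) ps in
    algorithm_state Bt s V1 1 st.1 st.2
| next_iteration k V H ps :
    algorithm_state Bt s V1 k.+1 V H -> H <> [::] ->
    perm_eq ps (all_pairs H) ->
    let st := process Bt V ps in
    algorithm_state Bt s V1 k.+2 st.1 st.2.

Definition terminates_after Bt s V1 (k : nat) (V : seq (set 'cV[R]_d)) : Prop :=
  (0 < k)%N /\ algorithm_state Bt s V1 k V [::].

End Families.

(* Main.v *)
(* The norm is the support function [f] of the final body [G].  Every set of the
   final family is mapped into [G] by each normalized matrix and is itself the
   image of a set of the family, so [max_i f(A_i x) = nu f(x)], which forces the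
   joint spectral radius to be [nu]; irreducibility makes [f] definite.

   For uniqueness, let [g] be another Barabanov norm and follow a trajectory on
   which [f] is constant.  A set of the family that touches at time [n.+1]
   (attains [f] there) has an image touching at time [n], hence not interior to
   [G]: backwards in time one descends the finite tree of the algorithm, unless
   one runs along the root cycle.  So after finitely many steps only root sets
   touch, the trajectory spells the candidate word, and, this word being
   primitive, at some time [V_1] alone touches.  Take such points [y] and [z] on
   trajectories starting where [g / f] is maximal, resp. minimal, normalized to
   [f = 1], and match them on [V_1].  Then the segment from [z] to [y] may be
   extended beyond [y] inside the unit ball of [f], and convexity of [g] along it
   gives [max g / f <= min g / f]. *)
Require Import Defs.
From mathcomp Require Import all_boot all_order all_algebra.
From mathcomp Require Import all_classical all_reals all_analysis.
From mathcomp Require Import complex.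
From mathcomp Require Import ring lra zify.
Import Order.TTheory GRing.Theory Num.Theory.
Import numFieldNormedType.Exports.
Local Open Scope classical_set_scope.
Local Open Scope ring_scope.
Set Implicit Arguments.
Unset Strict Implicit.
Unset Printing Implicit Defensive.

(** * Polytopes *)

Section Dotp.
Variables (R : realType) (d : nat).
Implicit Types (u v x y : 'cV[R]_d) (M : 'M[R]_d).

Lemma dotpE u x : dotp u x = (u^T *m x) 0 0.
Proof. by rewrite mxE; apply: eq_bigr => j _; rewrite mxE. Qed.

Lemma dotpC u x : dotp u x = dotp x u.
Proof. by apply: eq_bigr => j _; rewrite mulrC. Qed.

Lemma dotpDr u x y : dotp u (x + y) = dotp u x + dotp u y.
Proof. by rewrite !dotpE mulmxDr mxE. Qed.

Lemma dotpZr (c : R) u x : dotp u (c *: x) = c * dotp u x.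
Proof. by rewrite !dotpE -scalemxAr mxE. Qed.

Lemma dotpDl u v x : dotp (u + v) x = dotp u x + dotp v x.
Proof. by rewrite dotpC dotpDr !(dotpC x). Qed.

Lemma dotpZl (c : R) u x : dotp (c *: u) x = c * dotp u x.
Proof. by rewrite dotpC dotpZr dotpC. Qed.

Lemma dotpNl u x : dotp (- u) x = - dotp u x.
Proof. by rewrite -scaleN1r dotpZl mulN1r. Qed.

Lemma dotpNr u x : dotp u (- x) = - dotp u x.
Proof. by rewrite -scaleN1r dotpZr mulN1r. Qed.

Lemma dotp0l x : dotp 0 x = 0.
Proof. by rewrite -(scale0r (0 : 'cV_d)) dotpZl mul0r. Qed.

Lemma dotp_mulmx M u x : dotp (M *m u) x = dotp u (M^T *m x).
Proof. by rewrite !dotpE trmx_mul mulmxA. Qed.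

Lemma dotp_gt0 u : u != 0 -> 0 < dotp u u.
Proof.
move=> u0; rewrite lt_neqAle eq_sym sumr_ge0 ?andbT => [|j _]; last exact: sqr_ge0.
apply: contra u0 => /eqP/psumr_eq0P u0; apply/eqP/matrixP => j k.
rewrite ord1 mxE; have /eqP := u0 (fun j _ => sqr_ge0 _) j isT.
by rewrite mulf_eq0 orbb => /eqP.
Qed.

End Dotp.

Section Hull.
Variables (R : realType) (d : nat).
Implicit Types (X Y C : set 'cV[R]_d) (u v x y : 'cV[R]_d).

Lemma convex_setE C : convex_set C <->
  forall x y (t : R), C x -> C y -> 0 <= t <= 1 -> C (t *: x + (1 - t) *: y).
Proof.
split=> [cC x y t Cx Cy /andP[t0 t1]|cC x y t /set_mem Cx /set_mem Cy].
  have := cC x y (Itv01 t0 t1).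
  by rewrite !inE; apply.
by rewrite inE; apply: cC => //; rewrite ge0 le1.
Qed.

Lemma sub_convex_hull X : X `<=` convex_hull X.
Proof. by move=> x Xx C [_]; apply. Qed.

Lemma convex_hull_min X C : convex_set C -> X `<=` C -> convex_hull X `<=` C.
Proof. by move=> cC XC x; apply. Qed.

Lemma convex_hullS X Y : X `<=` Y -> convex_hull X `<=` convex_hull Y.
Proof.
move=> XY x hx C [cC YC]; apply: hx; split=> //; exact: subset_trans YC.
Qed.

Lemma convex_hull_dotp_le X x (c : R) :
  (forall u, X u -> dotp u x <= c) -> forall u, convex_hull X u -> dotp u x <= c.
Proof.
move=> Xc; apply: (@convex_hull_min _ [set u | dotp u x <= c]) => //.
apply/convex_setE => u v t /= uc vc /andP[t0 t1].
by rewrite dotpDl !dotpZl; nra.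
Qed.

(* Perturb the linear form by the strictly convex [dotp u u], weighted so little
   that no new maximizer appears among the finitely many generators: a maximizer
   of the sum is an extreme point. *)
Lemma vertex_argmax (F : seq 'cV[R]_d) x : F <> [::] ->
  exists2 v, v \in F /\ vertices (convex_hull [set` F]) v &
    forall u, u \in F -> dotp u x <= dotp v x.
Proof.
move=> F0.
have argmax (h : 'cV[R]_d -> R) : exists2 v, v \in F & forall u, u \in F -> h u <= h v.
  elim: F F0 => // a [|b F] IH _.
    by exists a; rewrite ?mem_head // => u; rewrite inE => /eqP ->.
  have [//|v vF vmax] := IH; have [av|va] := leP (h a) (h v).
    exists v; first by rewrite inE vF orbT.
    by move=> u; rewrite inE => /predU1P[->|/vmax].
  exists a; first exact: mem_head.
  by move=> u; rewrite inE => /predU1P[->//|/vmax/le_trans]; apply; apply: ltW.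
have [w wF wmax] := argmax (fun u => dotp u x).
have [M M0 HM] : exists2 M : R, 0 <= M & forall u, u \in F -> dotp u x < dotp w x ->
    dotp u u + M * dotp u x < dotp w w + M * dotp w x.
  elim: {F0 argmax wF} F wmax => [_|a F IH wmax]; first by exists 0.
  have [|M M0 HM] := IH; first by move=> u uF; apply: wmax; rewrite inE uF orbT.
  have [ax|ax] := leP (dotp w x) (dotp a x).
    exists M => // u; rewrite inE => /predU1P[-> /lt_le_trans/(_ ax)|].
      by rewrite ltxx.
    exact: HM.
  (* [N] exceeds the gap between the quadratic terms divided by the gap between the linear ones, so
     the linear term decides against [a]. Adding it to [M] keeps the earlier strict inequalities. *)
  pose N := `|dotp a a - dotp w w| / (dotp w x - dotp a x) + 1.
  have wa : 0 < dotp w x - dotp a x by rewrite subr_gt0.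
  have N0 : 0 <= N by rewrite addr_ge0 // divr_ge0 // ltW.
  exists (M + N); first exact: addr_ge0.
  move=> u; rewrite inE => /predU1P[-> _|/HM + ux]; last first.
    by have := ler_wpM2l N0 (ltW ux); move=> + /(_ ux); rewrite !mulrDl; lra.
  have : `|dotp a a - dotp w w| < N * (dotp w x - dotp a x).
    by rewrite /N mulrDl divfK ?gt_eqF // mul1r; lra.
  have := ler_norm (dotp a a - dotp w w).
  have : M * dotp a x <= M * dotp w x by rewrite ler_wpM2l // ltW // -subr_gt0.
  by rewrite !mulrDl; lra.
pose h u := dotp u u + M * dotp u x.
have [v vF vmax] := argmax h.
(* Strict convexity of [h] as an identity: the defect is [t (1 - t)] times a squared distance. *)
have hE u y (t : R) : h (t *: u + (1 - t) *: y) =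
    t * h u + (1 - t) * h y - t * (1 - t) * dotp (u - y) (u - y).
  rewrite /h !(dotpDl, dotpDr, dotpZl, dotpZr, dotpNl, dotpNr) (dotpC y u); ring.
have hull_le u : convex_hull [set` F] u -> h u <= h v.
  move: u; apply: (@convex_hull_min _ [set u | h u <= h v]) => //.
  apply/convex_setE => u y t /= hu hy /andP[t0 t1]; rewrite hE.
  have : 0 <= dotp (u - y) (u - y) by apply: sumr_ge0 => j _; apply: sqr_ge0.
  have : 0 <= t * (1 - t) by rewrite mulr_ge0 // subr_ge0.
  by nra.
exists v; last first.
  move=> u uF; apply: (le_trans (wmax _ uF)); rewrite leNgt; apply/negP => vw.
  by have := HM _ vF vw; rewrite ltNge vmax.
split=> //; split; first exact: sub_convex_hull.
move=> u y t hu hy t0 t1 vE.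
have [uy|uy] := eqVneq u y.
  by rewrite uy -scalerDl addrC subrK scale1r in vE; rewrite uy vE.
have uy0 : 0 < dotp (u - y) (u - y) by rewrite dotp_gt0 // subr_eq0.
have tt : 0 < t * (1 - t) by rewrite mulr_gt0 // subr_gt0.
move: (hE u y t) (hull_le _ hu) (hull_le _ hy); rewrite -vE => hv hhu hhy.
by exfalso; have := mulr_gt0 tt uy0; clear - hv hhu hhy t0 t1; nra.
Qed.

End Hull.

(** * Support functions *)

Section Support.
Variables (R : realType) (d : nat).
Implicit Types (X : set 'cV[R]_d) (a b u v x y : 'cV[R]_d) (M : 'M[R]_d).

Definition supp X x : R := sup [set dotp u x | u in X].

(* Both [{v, -v}] (with [b = 0]) and [Phi a b unit_circle] are of this kind. *)
Definition elliptic X := exists a b, forall x,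
  is_max [set dotp u x | u in X] (Num.sqrt (dotp a x ^+ 2 + dotp b x ^+ 2)).

Lemma is_max_sup (S : set R) r : is_max S r -> sup S = r.
Proof.
move=> [Sr ub]; apply/eqP; rewrite eq_le ge_sup ?ub_le_sup //; last by exists r.
by exists r.
Qed.

Lemma is_max_supp X x : elliptic X -> is_max [set dotp u x | u in X] (supp X x).
Proof. by move=> [a [b abX]]; rewrite /supp (is_max_sup (abX x)). Qed.

Lemma supp_attained X x : elliptic X -> exists2 u, X u & dotp u x = supp X x.
Proof. by move=> /(is_max_supp x)[]. Qed.

Lemma dotp_le_supp X u x : elliptic X -> X u -> dotp u x <= supp X x.
Proof. by move=> /(is_max_supp x)[_ ub] Xu; apply: ub; exists u. Qed.

Lemma supp_ge0 X x : elliptic X -> 0 <= supp X x.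
Proof. by move=> [a [b abX]]; rewrite /supp (is_max_sup (abX x)) sqrtr_ge0. Qed.

Lemma suppZ X (c : R) x : elliptic X -> supp X (c *: x) = `|c| * supp X x.
Proof.
move=> [a [b abX]]; rewrite /supp !(is_max_sup (abX _)) !dotpZr !exprMn -mulrDr.
by rewrite sqrtrM ?sqr_ge0 // sqrtr_sqr.
Qed.

Lemma suppD X x y : elliptic X -> supp X (x + y) <= supp X x + supp X y.
Proof.
move=> eX; have [u Xu <-] := supp_attained (x + y) eX.
by rewrite dotpDr lerD // dotp_le_supp.
Qed.

Lemma apply_set_dotp M X x :
  [set dotp u x | u in apply_set M X] = [set dotp u (M^T *m x) | u in X].
Proof.
apply/seteqP; split=> [_ [_ [u Xu <-] <-]|_ [u Xu <-]].
  by exists u; rewrite // dotp_mulmx.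
by exists (M *m u); [exists u|rewrite dotp_mulmx].
Qed.

Lemma elliptic_apply M X : elliptic X -> elliptic (apply_set M X).
Proof.
move=> [a [b abX]]; exists (M *m a), (M *m b) => x.
by rewrite apply_set_dotp !dotp_mulmx.
Qed.

(** Duality: mapping the set by [M] amounts to moving the point by [M^T]. Thus the tree of sets
    built from the [A_i^T] is read off along trajectories of the [A_i]. *)
Lemma supp_apply M X x : supp (apply_set M X) x = supp X (M^T *m x).
Proof. by rewrite /supp apply_set_dotp. Qed.

Lemma is_max_pair v x : is_max [set dotp u x | u in [set v; - v]] `|dotp v x|.
Proof.
split; last first.
  move=> _ [_ [->|->] <-]; rewrite ?dotpNl ?ler_norm //.
  by rewrite -normrN ler_norm.
have [v0|v0] := lerP 0 (dotp v x).
  by exists v; [left|rewrite ?ger0_norm].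
by exists (- v); [right|rewrite ?dotpNl ?ltr0_norm].
Qed.

Lemma elliptic_pair v : elliptic [set v; - v].
Proof.
exists v, 0 => x; rewrite dotp0l expr0n addr0 sqrtr_sqr; exact: is_max_pair.
Qed.

Lemma supp_pair v x : supp [set v; - v] x = `|dotp v x|.
Proof. exact: is_max_sup (is_max_pair v x). Qed.

(** The bound is the Cauchy-Schwarz inequality; equality occurs at the unit vector along
    [(dotp a x, dotp b x)], or anywhere on the circle if that pair vanishes. *)
Lemma is_max_Phi a b x : is_max [set dotp u x | u in Phi a b (@unit_circle R)]
  (Num.sqrt (dotp a x ^+ 2 + dotp b x ^+ 2)).
Proof.
set r := Num.sqrt _; have r0 : 0 <= r by exact: sqrtr_ge0.
have rE : r ^+ 2 = dotp a x ^+ 2 + dotp b x ^+ 2.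
  by rewrite sqr_sqrtr // addr_ge0 ?sqr_ge0.
split; last first.
  move=> _ [_ [p /= p1 <-] <-]; rewrite dotpDl !dotpZl.
  rewrite leNgt; apply/negP => rlt.
  (* By Lagrange's identity this square is the defect in the Cauchy-Schwarz inequality. *)
  have := sqr_ge0 (p.1 * dotp b x - p.2 * dotp a x).
  rewrite /unit_circle /= in p1.
  have : r ^+ 2 < (p.1 * dotp a x + p.2 * dotp b x) ^+ 2.
    by rewrite ltr_sqr ?nnegrE // ?(le_trans r0) // ltW.
  rewrite rE -[X in X < _]mul1r -p1; nra.
have [r_eq0|r_neq0] := eqVneq r 0.
  have ab0 : dotp a x = 0 /\ dotp b x = 0.
    by have := sqr_ge0 (dotp a x); have := sqr_ge0 (dotp b x); move: rE; rewrite r_eq0; split; nra.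
  exists (1 *: a + 0 *: b); last by rewrite dotpDl !dotpZl ab0.1 ab0.2 r_eq0 !mulr0 addr0.
  by exists (1, 0) => //; rewrite /unit_circle /= expr1n expr0n addr0.
exists ((dotp a x / r) *: a + (dotp b x / r) *: b).
  exists (dotp a x / r, dotp b x / r) => //; rewrite /unit_circle /=.
  by rewrite !expr_div_n -mulrDl -rE divff // expf_neq0.
by rewrite dotpDl !dotpZl; apply: (mulfI r_neq0); rewrite -expr2 rE; field.
Qed.

Lemma elliptic_Phi a b : elliptic (Phi a b (@unit_circle R)).
Proof. by exists a, b => x; exact: is_max_Phi. Qed.

Lemma supp_Phi a b x : supp (Phi a b (@unit_circle R)) x =
  Num.sqrt (dotp a x ^+ 2 + dotp b x ^+ 2).
Proof. exact: is_max_sup (is_max_Phi a b x). Qed.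

Lemma apply_pair M v : apply_set M [set v; - v] = [set M *m v; - (M *m v)].
Proof. by rewrite /apply_set image_setU !image_set1 mulmxN. Qed.

Lemma apply_Phi M a b K : apply_set M (Phi a b K) = Phi (M *m a) (M *m b) K.
Proof.
rewrite /apply_set /Phi image_comp; apply: eq_imagel => p _ /=.
by rewrite mulmxDr -!scalemxAr.
Qed.

End Support.

Section MaxSupport.
Variables (R : realType) (d : nat).
Implicit Types (V : seq (set 'cV[R]_d)) (X : set 'cV[R]_d) (x y : 'cV[R]_d).

(** The support function of [body V] for a nonempty list of elliptic sets; their supports are
    nonnegative, so starting the maximum at 0 does not alter it. *)
Definition maxsupp V x : R := \big[Num.max/0]_(X <- V) supp X x.

Lemma supp_le_max V X x : X \in V -> supp X x <= maxsupp V x.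
Proof. by move=> XV; rewrite /maxsupp; apply: Order.TotalTheory.bigmax_sup_seq XV _ _. Qed.

Definition all_elliptic V := forall X, X \in V -> elliptic X.

Lemma maxsupp_attained V x : V <> [::] -> all_elliptic V ->
  exists2 X, X \in V & supp X x = maxsupp V x.
Proof.
elim: V => [//|X V IH] _ ellV; rewrite /maxsupp.
have ellV' : all_elliptic V by move=> Y YV; apply: ellV; rewrite inE YV orbT.
case: V IH ellV' {ellV} => [|Y V] IH ellV' in ellV *.
  exists X; first exact: mem_head.
  by rewrite big_cons big_nil max_l //; apply: supp_ge0; apply: ellV; rewrite mem_head.
have [//|//|Z ZV ZE] := IH.
rewrite big_cons -[\big[_/_]_(_ <- _) _]/(maxsupp (Y :: V) x) -ZE.
have [ZX|XZ] := leP (supp Z x) (supp X x).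
  by exists X; rewrite ?mem_head // max_l.
by exists Z; rewrite ?max_r ?(ltW XZ) // inE ZV orbT.
Qed.

Lemma maxsupp_ge0 V x : 0 <= maxsupp V x.
Proof. exact: bigmax_ge_id. Qed.

Lemma maxsuppZ V (c : R) x : all_elliptic V ->
  maxsupp V (c *: x) = `|c| * maxsupp V x.
Proof.
elim: V => [|X V IH] ellV; rewrite /maxsupp ?big_nil ?mulr0 // !big_cons.
rewrite suppZ; last by apply: ellV; rewrite mem_head.
rewrite -!/(maxsupp _ _) IH ?maxr_pMr //.
by move=> Y YV; apply: ellV; rewrite inE YV orbT.
Qed.

Lemma maxsuppD V x y : all_elliptic V ->
  maxsupp V (x + y) <= maxsupp V x + maxsupp V y.
Proof.
move=> ellV; rewrite {1}/maxsupp big_seq.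
apply: bigmax_le; first by rewrite addr_ge0 ?maxsupp_ge0.
move=> X XV; apply: le_trans (suppD x y (ellV X XV)) _.
by rewrite lerD ?supp_le_max.
Qed.

Lemma body_dotp_le V u x : all_elliptic V -> body V u -> dotp u x <= maxsupp V x.
Proof.
move=> ellV; apply: convex_hull_dotp_le => {}u.
rewrite -bigcup_seq => -[X /= XV Xu].
exact: le_trans (dotp_le_supp x (ellV X XV) Xu) (supp_le_max _ XV).
Qed.

(** An interior point can be pushed slightly along [x] inside the body, which raises [dotp _ x].
    Hence a set skipped by the algorithm never touches. *)
Lemma interior_dotp_lt V u x : all_elliptic V -> interior (body V) u -> x != 0 ->
  dotp u x < maxsupp V x.
Proof.
move=> ellV; rewrite /interior => /nbhs_ballP[e /= e0 sub] x0.
have nx : 0 < `|x| by rewrite normr_gt0.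
pose t := e / 2 / `|x|; have t0 : 0 < t by rewrite !divr_gt0.
have : body V (u + t *: x).
  apply: sub; rewrite -ball_normE /= opprD addNKr normrN normrZ gtr0_norm // divfK ?gt_eqF //.
  by rewrite ltr_pdivrMr // ltr_pMr // ltr1n.
move=> /(body_dotp_le x ellV); apply: lt_le_trans.
by rewrite dotpDl dotpZl ltrDl mulr_gt0 // dotp_gt0.
Qed.

End MaxSupport.

(** * Norms and the joint spectral radius *)

Section MatrixNorm.
Variables (R : realType) (m n : nat).
Implicit Types (M : 'M[R]_(m, n)).

Lemma entry_le_norm M i j : `|M i j| <= `|M|.
Proof. rewrite [leRHS]mx_normrE; exact: (le_bigmax _ _ (i, j)). Qed.

Lemma norm_le_entries M (c : R) :
  0 <= c -> (forall i j, `|M i j| <= c) -> `|M| <= c.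
Proof. by move=> c0 Mc; rewrite [leLHS]mx_normrE; apply: bigmax_le. Qed.

End MatrixNorm.

Section Norms.
Variables (R : realType) (d : nat).
Implicit Types (f g : 'cV[R]_d -> R) (x y : 'cV[R]_d).

Lemma is_norm0 f : is_norm f -> f 0 = 0.
Proof. by move=> [_ _ fZ _]; rewrite -(scale0r (0 : 'cV_d)) fZ normr0 mul0r. Qed.

Lemma is_normN f x : is_norm f -> f (- x) = f x.
Proof. by move=> [_ _ fZ _]; rewrite -scaleN1r fZ normrN1 mul1r. Qed.

Lemma is_norm_gt0 f x : is_norm f -> x != 0 -> 0 < f x.
Proof.
move=> [f0 fx0 _ _] x0; rewrite lt_neqAle f0 andbT eq_sym.
by apply: contra x0 => /eqP/fx0 ->.
Qed.

Lemma is_norm_dist f x y : is_norm f -> `|f x - f y| <= f (x - y).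
Proof.
move=> nf; have [_ _ _ fD] := nf.
rewrite ler_norml lerBlDr lerNl opprB !lerBlDr; apply/andP; split.
  by rewrite -(is_normN (x - y) nf) opprB (le_trans _ (fD _ _)) // subrK.
by rewrite (le_trans _ (fD _ _)) // subrK.
Qed.

(** Expand [w] in the standard basis. Row vectors are used to match [EVT_max_rV]; the summand 1
    keeps [C] positive. *)
Lemma is_norm_le f : is_norm f ->
  exists2 C : R, 0 < C & forall w : 'rV[R]_d, f w^T <= C * `|w|.
Proof.
move=> nf; have [f0 _ fZ fD] := nf.
exists (1 + \sum_j f (delta_mx 0 j)^T); first by rewrite ltr_wpDr // sumr_ge0.
move=> w; rewrite [in leLHS](row_sum_delta w) raddf_sum /=.
apply: (@le_trans _ _ (\sum_j `|w| * f (delta_mx 0 j)^T)).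
  elim/big_ind2 : _ => [|u a v b fu fv|j _]; first by rewrite is_norm0.
    by apply: le_trans (fD _ _) _; rewrite lerD.
  by rewrite linearZ /= fZ ler_wpM2r // entry_le_norm.
by rewrite -mulr_sumr mulrC ler_wpM2r // lerDr.
Qed.

Lemma is_norm_continuous f : is_norm f -> continuous (fun w : 'rV[R]_d => f w^T).
Proof.
move=> nf w; have [C C0 fC] := is_norm_le nf.
apply/(@cvgrPdist_lt _ _ _ (nbhs w)) => e e0; apply/nbhs_ballP.
exists (e / C); first by rewrite /= divr_gt0.
move=> v; rewrite -ball_normE /= => wv.
apply: le_lt_trans (is_norm_dist _ _ nf) _; rewrite -linearB.
by apply: le_lt_trans (fC _) _; rewrite mulrC -ltr_pdivlMr.
Qed.

(** The continuous ratio [g / f] attains its maximum on the compact unit sphere, and homogeneity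
    carries this to all vectors. The cross-multiplied form includes [z = 0]. *)
Lemma norm_ratio_max f g : (0 < d)%N -> is_norm f -> is_norm g ->
  exists2 x, x != 0 & forall z, g z * f x <= g x * f z.
Proof.
move=> d_gt0 nf ng.
pose S := [set w : 'rV[R]_d | `|w| = 1].
have S_neq0 w : S w -> w^T != 0.
  rewrite /S /=; apply: contra_eqN => /eqP w0.
  by rewrite -(trmxK w) w0 trmx0 normr0 eq_sym oner_eq0.
have Sn0 : S !=set0.
  have e0 : delta_mx 0 (Ordinal d_gt0) != 0 :> 'rV[R]_d.
    apply/eqP => /matrixP/(_ 0 (Ordinal d_gt0)); rewrite !mxE !eqxx => /eqP.
    by rewrite oner_eq0.
  exists (`|delta_mx 0 (Ordinal d_gt0) : 'rV[R]_d|^-1 *: delta_mx 0 (Ordinal d_gt0)).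
  by rewrite /S /= normrZ normfV normr_id mulVf // normr_eq0.
have cS : compact S.
  apply: bounded_closed_compact.
    by exists 1; split=> // r r1 w /= ->; apply: ltW.
  rewrite (_ : S = (fun w : 'rV[R]_d => `|w|) @^-1` [set t | t = 1]) //.
  by apply: preimage_closed; [move=> w _; exact: norm_continuous|exact: closed_eq].
have [|w Sw wmax] := @EVT_max_rV R d (fun w => g w^T / f w^T) S Sn0 cS.
  apply: continuous_in_subspaceT => w /set_mem Sw.
  apply: (@continuousM R 'rV[R]_d (fun w => g w^T) (fun w => (f w^T)^-1)).
    exact: is_norm_continuous.
  apply: (@continuousV R 'rV[R]_d (fun w => f w^T)); last exact: is_norm_continuous.
  by rewrite gt_eqF // is_norm_gt0 // S_neq0.
move: Sw => /set_mem/S_neq0 w0; exists w^T => // z.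
have [->|z0] := eqVneq z 0; first by rewrite !is_norm0 // mul0r mulr0.
have nz : 0 < `|z^T| :> R.
  by rewrite normr_gt0; apply: contra z0 => /eqP z0; rewrite -(trmxK z) z0 trmx0.
have /wmax : `|z^T|^-1 *: z^T \in S.
  by rewrite inE /S /= normrZ normfV normr_id mulVf // gt_eqF.
have [_ _ fZ _] := nf; have [_ _ gZ _] := ng.
rewrite linearZ /= trmxK fZ gZ -mulf_div divff ?mul1r; last first.
  by rewrite normr_eq0 invr_eq0 gt_eqF.
by rewrite ler_pdivrMr ?is_norm_gt0 // mulrAC ler_pdivlMr ?is_norm_gt0.
Qed.

End Norms.

Section JointSpectralRadius.
Variables (R : realType) (d m : nat).
Implicit Types (A : 'I_m -> 'M[R]_d).

Lemma word_prod_rcons A s i : word_prod A (rcons s i) = A i *m word_prod A s.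
Proof. by rewrite /word_prod -cats1 foldl_cat. Qed.

Definition norm_of_sup : 'cV[R]_d -> R := fun x => `|x|.

Lemma is_norm_sup : is_norm norm_of_sup.
Proof.
split=> [x|x /eqP|c x|x y]; [exact: normr_ge0| |exact: normrZ|exact: ler_normD].
by rewrite normr_eq0 => /eqP.
Qed.

Lemma norm_mulmx_le (M : 'M[R]_d) (x : 'cV[R]_d) : `|M *m x| <= d%:R * `|M| * `|x|.
Proof.
apply: norm_le_entries => [|i j]; first by rewrite !mulr_ge0.
rewrite mxE; apply: le_trans (ler_norm_sum _ _ _) _.
rewrite -[d in d%:R]card_ord -mulrA mulr_natl -sumr_const ler_sum // => k _.
by rewrite normrM ler_pM // entry_le_norm.
Qed.

Lemma cvg_powR_root (C : R) : 0 < C -> (fun n : nat => C `^ n%:R^-1) @ \oo --> (1 : R).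
Proof.
move=> C_gt0; have inv0 : (fun n : nat => n%:R^-1 : R) @ \oo --> (0 : R).
  apply/(gtr0_cvgV0 (f := fun n => n%:R)); last exact: cvgr_idn.
  by near=> n; rewrite ltr0n; near: n; exact: nbhs_infty_gt.
have -> : (fun n : nat => C `^ n%:R^-1) = (fun n => expR (n%:R^-1 * ln C)).
  by apply/funext => n; rewrite /powR gt_eqF.
rewrite -[X in _ --> X](@expR0 R) -[X in expR X](mul0r (ln C)).
apply: (@continuous_cvg _ _ _ _ _ _ expR); first exact: continuous_expR.
exact: (cvgM inv0 (cvg_cst _)).
Unshelve. all: by end_near. Qed.

(* [f] pins the growth of the products down to [C1 r^n <= max <= C2 r^n]. *)
Lemma jsr_extremal A f (r : R) : (0 < d)%N -> 0 < r -> is_norm f ->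
  (forall x, is_max (range (fun i => f (A i *m x))) (r * f x)) -> jsr A = r.
Proof.
move=> d_gt0 r_gt0 nf maxf; have [f0 _ _ _] := nf.
have up n (w : n.-tuple 'I_m) x : f (word_prod A w *m x) <= r ^+ n * f x.
  case: w => w /= /eqP <-; elim/last_ind: w => [|w i IH].
    by rewrite mul1mx expr0 mul1r.
  rewrite word_prod_rcons -mulmxA size_rcons exprS -mulrA.
  have [_ ub] := maxf (word_prod A w *m x).
  by apply: le_trans (ub _ _) (ler_wpM2l (ltW r_gt0) IH); exists i.
(* Choosing at each step an index that attains the maximum makes [f] grow by exactly the factor
   [r]. *)
have low n x : exists w : n.-tuple 'I_m, f (word_prod A w *m x) = r ^+ n * f x.
  elim: n => [|n [w IH]]; first by exists [tuple]; rewrite mul1mx expr0 mul1r.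
  have [[i _ iE] _] := maxf (word_prod A w *m x).
  exists [tuple of rcons w i]; rewrite word_prod_rcons -mulmxA iE IH.
  by rewrite exprS mulrA.
have [x1 x1_neq0 fs] := norm_ratio_max d_gt0 nf is_norm_sup.
have [x2 x2_neq0 sf] := norm_ratio_max d_gt0 is_norm_sup nf.
have fx1 := is_norm_gt0 nf x1_neq0; have fx2 := is_norm_gt0 nf x2_neq0.
have nx1 : 0 < `|x1| by rewrite normr_gt0.
have nx2 : 0 < `|x2| by rewrite normr_gt0.
rewrite /norm_of_sup in fs sf.
pose mx n := \big[Num.max/0]_(w : n.-tuple 'I_m) `|word_prod A w|.
have [D D_gt0 fD] := is_norm_le nf.
(* [|x1| / f x1] bounds the sup norm by [f], and [D] bounds [f] on the basis vectors, whose images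
   are the columns of the product. *)
pose C2 := `|x1| * D / f x1; have C2_gt0 : 0 < C2 by rewrite divr_gt0 ?mulr_gt0.
have mx_up n : mx n <= C2 * r ^+ n.
  apply: bigmax_le => [|w _]; first by rewrite mulr_ge0 ?exprn_ge0 // ltW.
  apply: norm_le_entries => [|i j]; first by rewrite mulr_ge0 ?exprn_ge0 // ltW.
  have -> : word_prod A w i j = (word_prod A w *m (delta_mx 0 j : 'rV_d)^T) i 0.
    by rewrite trmx_delta -colE mxE.
  apply: le_trans (entry_le_norm _ _ _) _.
  rewrite -(ler_pM2r fx1) (le_trans (fs _)) //.
  rewrite mulrAC divfK ?gt_eqF // -mulrA ler_wpM2l ?normr_ge0 //.
  rewrite mulrC (le_trans (up _ _ _)) // ler_wpM2l ?exprn_ge0 ?(ltW r_gt0) //.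
  rewrite (le_trans (fD _)) // ler_piMr ?(ltW D_gt0) //.
  apply: norm_le_entries => // k l.
  by rewrite mxE; case: (_ && _); rewrite ?normr0 ?normr1.
have mx_low n : d%:R^-1 * r ^+ n <= mx n.
  have [w wE] := low n x2.
  rewrite ler_pdivrMl ?ltr0n //; apply: (@le_trans _ _ (d%:R * `|word_prod A w|)).
    have := sf (word_prod A w *m x2); rewrite wE mulrAC mulrC ler_pM2l //.
    by move=> /le_trans/(_ (norm_mulmx_le _ _)); rewrite ler_pM2r.
  rewrite ler_wpM2l //; exact: le_bigmax.
have root_cvg (C : R) : 0 < C ->
    (fun n : nat => (C * r ^+ n) `^ n%:R^-1) @ \oo --> r.
  move=> C_gt0; rewrite -[X in _ --> X]mul1r.
  (* The identity is claimed only eventually: at [n = 0] the exponent [n%:R^-1] is 0. *)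
  have CE : \forall n \near \oo, C `^ n%:R^-1 * r = (C * r ^+ n) `^ n%:R^-1.
    near=> n; rewrite powRM ?exprn_ge0 ?(ltW C_gt0) ?(ltW r_gt0) //.
    rewrite -powR_mulrn ?(ltW r_gt0) // -powRrM divff ?powRr1 ?(ltW r_gt0) //.
    rewrite pnatr_eq0 -lt0n; near: n; exact: nbhs_infty_gt.
  by apply: cvg_trans (near_eq_cvg CE) _; exact: (cvgM (cvg_powR_root C_gt0) (cvg_cst _)).
apply: cvg_lim; first exact: norm_hausdorff.
apply: (squeeze_cvgr _ (@root_cvg d%:R^-1 _) (@root_cvg C2 C2_gt0)); last first.
  by rewrite invr_gt0 ltr0n.
have inv_ge0 n : 0 <= n%:R^-1 :> R by rewrite invr_ge0.
have mx_ge0 n : 0 <= mx n by apply: bigmax_ge_id.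
near=> n; apply/andP; split; apply: ge0_ler_powR; rewrite ?nnegrE //.
- by rewrite mulr_ge0 ?exprn_ge0 ?(ltW r_gt0) ?invr_ge0.
- exact: mx_ge0.
- exact: mx_ge0.
- by rewrite mulr_ge0 ?exprn_ge0 ?(ltW r_gt0) ?(ltW C2_gt0).
- exact: mx_up.
Unshelve. all: by end_near. Qed.

End JointSpectralRadius.

(** * Trajectories *)

Section PrimitiveWords.
Variable T : eqType.
Implicit Types (s u : seq T).

Lemma nth_flatten_nseq (x0 : T) k u i : (i < k * size u)%N ->
  nth x0 (flatten (nseq k u)) i = nth x0 u (i %% size u).
Proof.
elim: k i => [|k IH] i //=; rewrite mulSn nth_cat => ik.
have [iu|ui] := ltnP i (size u); first by rewrite modn_small.
by rewrite IH ?ltn_subLR // -[in RHS](subnK ui) modnDr.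
Qed.

(** Two equal cyclic shifts give the cyclic word the period [b - a], hence by Bezout the period gcd
    of [b - a] and the length. This divides the length and is smaller than it. *)
Lemma flatten_of_shift (x0 : T) s a b : (a < b < size s)%N ->
  (forall r, nth x0 s ((a + r) %% size s) = nth x0 s ((b + r) %% size s)) ->
  exists (u : seq T) (p : nat), (size u < size s)%N /\ s = flatten (nseq p u).
Proof.
set n := size s => /andP[ab bn] shift.
have n_gt0 : (0 < n)%N by apply: leq_ltn_trans bn.
pose D := (b - a)%N; have D_gt0 : (0 < D)%N by rewrite subn_gt0.
have per t k : nth x0 s (t %% n) = nth x0 s ((t + k * D) %% n).
  elim: k => [|k ->]; first by rewrite addn0.
  have an : (a <= n)%N by apply: ltnW; apply: ltn_trans bn.
  (* The offset [n - a] completes [a] to a full turn, leaving an index that is arbitrary modulo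
     [n]. *)
  have := shift (t + k * D + (n - a))%N.
  have -> : (a + (t + k * D + (n - a)) = t + k * D + n)%N by lia.
  have -> : (b + (t + k * D + (n - a)) = t + k.+1 * D + n)%N by rewrite /D mulSn; lia.
  by rewrite !modnDr.
pose g := gcdn D n; have g_gt0 : (0 < g)%N by rewrite gcdn_gt0 D_gt0.
have gn : (g %| n)%N by exact: dvdn_gcdr.
have perg t : nth x0 s (t %% n) = nth x0 s ((t + g) %% n).
  case: (egcdnP n D_gt0) => kD kn kE _; rewrite (per t kD) kE.
  by rewrite addnCA modnMDl.
have perg' t k : nth x0 s (t %% n) = nth x0 s ((t + k * g) %% n).
  by elim: k => [|k ->]; rewrite ?addn0 // perg mulSn addnCA addnC.
have size_take : size (take g s) = g.
  by rewrite size_take; case: ltnP => // ng; apply/eqP; rewrite eqn_leq ng (dvdn_leq n_gt0 gn).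
exists (take g s), (n %/ g)%N; split.
  by rewrite size_take (leq_ltn_trans (dvdn_leq D_gt0 (dvdn_gcdl D n))) // /D; lia.
have sizeE : size (flatten (nseq (n %/ g) (take g s))) = n.
  by rewrite size_flatten /shape map_nseq sumn_nseq size_take mulnC divnK.
apply: (eq_from_nth (x0 := x0)); first by rewrite sizeE.
move=> i i_lt; rewrite nth_flatten_nseq size_take ?divnK // nth_take ?ltn_pmod //.
have := perg' (i %% g)%N (i %/ g)%N.
by rewrite addnC -divn_eq (modn_small i_lt) (modn_small (leq_ltn_trans (leq_mod _ _) i_lt)).
Qed.

End PrimitiveWords.

Section Trajectories.
Variables (R : realType) (E : Type) (m L : nat) (s : seq 'I_m).
Variables (T : 'I_m -> E -> E) (q : nat -> E -> R) (f : E -> R).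
Hypothesis s_primitive : primitive_word s.
Hypothesis root_le : (size s <= L)%N.
Hypothesis q_le : forall p x, (p < L)%N -> q p x <= f x.
Hypothesis q_attained : forall x, exists2 p, (p < L)%N & q p x = f x.

(* [q p] stands for the support function of the [p]-th set of the final family,
   whose first [size s] members are the root.  A family set whose image touches
   at [x] is sent to its child in the tree, further to the right in the list,
   except along the cycle of the root. *)
Hypothesis q_step : forall p i x, (p < L)%N -> 0 < f x ->
  [\/ q p (T i x) < f x,
      [/\ (p < size s)%N, i = nth i s p & q (p.+1 %% size s)%N x = q p (T i x)] |
      exists p', [/\ (size s <= p')%N, (p < p' < L)%N & q p' x = q p (T i x)]].

Lemma root_touched (x : nat -> E) (w : nat -> 'I_m) (r : R) : 0 < r ->
  (forall k, x k.+1 = T (w k) (x k)) -> (forall k, f (x k) = r) ->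
  exists k, q 0%N (x k) = r /\ forall p, (0 < p < L)%N -> q p (x k) < r.
Proof.
move=> r0 xS fx; set n := size s.
have n_gt0 : (0 < n)%N by rewrite lt0n size_eq0; apply/eqP; case: s_primitive.
pose touch p k := (p < L)%N && (q p (x k) == r).
have step p k : touch p k.+1 ->
    [/\ (p < n)%N, w k = nth (w k) s p & q (p.+1 %% n)%N (x k) = r] \/
    exists p', [/\ (n <= p')%N, (p < p')%N & touch p' k].
  move=> /andP[pL /eqP]; rewrite xS => qp.
  have fxk : 0 < f (x k) by rewrite fx.
  have [|[pn wk qpE]|[p' [np' /andP[pp' p'L] qp'E]]] := q_step (w k) pL fxk.
  - by rewrite qp fx ltxx.
  - by left; split=> //; rewrite qpE.
  - by right; exists p'; split=> //; rewrite /touch p'L qp'E qp eqxx.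
(* Each step back in time strictly increases a non-root index, and indices stay below [L]; from time
   [L] on, only root sets can touch. *)
have nonroot k : forall p, touch p k -> (n <= p)%N -> (k + p < L)%N.
  elim: k => [|k IH] p; first by case/andP.
  move=> /step[[pn]|[p' [np' pp' /IH-/(_ np')]]]; first by rewrite leqNgt pn.
  by move=> kp' _; apply: leq_ltn_trans kp'; rewrite addSnnS leq_add2l.
have late p k : touch p (L + k)%N -> (p < n)%N.
  by rewrite ltnNge => tp; apply/negP => /(nonroot _ _ tp); rewrite -addnA ltnNge leq_addr.
have [i0] : exists i0 : 'I_m, True.
  by case sE : s => [|i0 s']; [move: n_gt0; rewrite /n sE|exists i0].
move=> _.
have stepL j k : touch j (L + k).+1%N ->
    w (L + k)%N = nth i0 s j /\ touch (j.+1 %% n)%N (L + k)%N.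
  move=> /step[[jn -> qj]|[p' [np' _ /late]]]; last by rewrite ltnNge np'.
  split; first exact: set_nth_default.
  by rewrite /touch qj eqxx andbT (leq_trans _ root_le) // ltn_pmod.
have back t : forall j k, touch j (L + k + t)%N -> touch ((j + t) %% n)%N (L + k)%N.
  elim: t => [|t IH] j k.
    rewrite !addn0 => tj; rewrite modn_small //; exact: (late _ _ tj).
  by rewrite !addnS -addnA => /stepL[_]; rewrite addnA => /IH; rewrite modnDml addSn.
have word j k t : touch j (L + (k + t).+1)%N -> w (L + k)%N = nth i0 s ((j + t) %% n).
  by rewrite addnS addnA -addSn -addnS => /back; rewrite addnS => /stepL[].
(* Two root sets touching together would read the same [n] letters of the trajectory from two
   positions of [s], against primitivity. *)
have same j j' k : touch j (L + n + k)%N -> touch j' (L + n + k)%N -> ~~ (j < j')%N.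
  move=> tj tj'; apply/negP => jj'.
  have [_] := s_primitive; apply; apply: (@flatten_of_shift _ i0 s j j').
    by rewrite jj'; apply: (@late _ (n + k)%N); rewrite addnA.
  move=> t; rewrite -(modnDmr j) -(modnDmr j') -/n; have := ltn_pmod t n_gt0.
  move: (t %% n)%N => {}t tn.
  have kE : (L + n + k = L + ((n - t.+1 + k) + t).+1)%N by lia.
  by move: tj tj'; rewrite kE => /word <- /word <-.
have [p pL qp] := q_attained (x (L + n + n)%N).
have tp : touch p (L + n + n)%N by rewrite /touch pL qp fx eqxx.
have pn : (p < n)%N by apply: (@late _ (n + n)%N); rewrite addnA.
(* From index [p] at time [L + n + n], going back [n - p] steps leads round the cycle to index 0, at
   a time still late enough for [same]. *)
exists (L + n + p)%N.
have t0 : touch 0%N (L + n + p)%N.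
  have := back (n - p)%N p (n + p)%N; rewrite subnKC ?(ltnW pn) // modnn addnA.
  have -> : (L + n + p + (n - p) = L + n + n)%N by lia. exact.
split; first by case/andP: t0 => _ /eqP.
move=> p' /andP[p'0 p'L]; rewrite lt_neqAle.
rewrite -[X in _ <= X](fx (L + n + p)%N) q_le // andbT.
apply/negP => qp'; have tp' : touch p' (L + n + p)%N by rewrite /touch p'L.
by have := same _ _ _ t0 tp'; rewrite p'0.
Qed.

End Trajectories.

(** * Uniqueness of the extremal norm up to scaling *)

Section Uniqueness.
Variables (R : realType) (d m L : nat) (s : seq 'I_m).
Variables (T : 'I_m -> 'cV[R]_d -> 'cV[R]_d) (q : nat -> 'cV[R]_d -> R).
Variable f : 'cV[R]_d -> R.
Hypothesis d_gt0 : (0 < d)%N.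
Hypothesis s_primitive : primitive_word s.
Hypothesis root_le : (size s <= L)%N.
Hypothesis f_norm : is_norm f.
Hypothesis f_max : forall x, is_max (range (fun i => f (T i x))) (f x).
Hypothesis qZ : forall p (c : R) x, (p < L)%N -> q p (c *: x) = `|c| * q p x.
Hypothesis qD : forall p x y, (p < L)%N -> q p (x + y) <= q p x + q p y.
Hypothesis q_le : forall p x, (p < L)%N -> q p x <= f x.
Hypothesis q_attained : forall x, exists2 p, (p < L)%N & q p x = f x.
Hypothesis q_step : forall p i x, (p < L)%N -> 0 < f x ->
  [\/ q p (T i x) < f x,
      [/\ (p < size s)%N, i = nth i s p & q (p.+1 %% size s)%N x = q p (T i x)] |
      exists p', [/\ (size s <= p')%N, (p < p' < L)%N & q p' x = q p (T i x)]].

(* The only place where the leading eigenvalue matters: a sign change does it in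
   the real case, density of the orbits of an irrational rotation otherwise. *)
Hypothesis root_match : forall y z (e : R), q 0%N y = 1 -> q 0%N z = 1 -> 0 < e ->
  exists2 z', q 0%N (y - z') <= e &
    forall h, is_norm h -> (forall i x, h (T i x) <= h x) -> h z' <= h z.

Lemma extremal_norm_unique (g : 'cV[R]_d -> R) : is_norm g ->
  (forall x, is_max (range (fun i => g (T i x))) (g x)) ->
  exists2 c : R, 0 < c & forall x, g x = c * f x.
Proof.
move=> g_norm g_max.
have gT i x : g (T i x) <= g x by have [_] := g_max x; apply; exists i.
have fT i x : f (T i x) <= f x by have [_] := f_max x; apply; exists i.
have [x1 x1_neq0 x1P] := norm_ratio_max d_gt0 f_norm g_norm.
have [x2 x2_neq0 x2P] := norm_ratio_max d_gt0 g_norm f_norm.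
have fx1 := is_norm_gt0 f_norm x1_neq0; have gx1 := is_norm_gt0 g_norm x1_neq0.
have fx2 := is_norm_gt0 f_norm x2_neq0; have gx2 := is_norm_gt0 g_norm x2_neq0.
pose C := g x1 / f x1; pose c := g x2 / f x2.
have C_gt0 : 0 < C by rewrite divr_gt0.
have gC x : g x <= C * f x by rewrite /C mulrAC ler_pdivlMr.
have cg x : c * f x <= g x by rewrite /c mulrAC ler_pdivrMr // mulrC [leRHS]mulrC.
have [_ _ fZ _] := f_norm; have [_ _ gZ gD] := g_norm.
(* Along choices that maximize [g], the ratio [g / f] remains maximal. *)
have [y [fy gy q0y qy]] : exists y, [/\ f y = 1, g y = C, q 0%N y = 1 &
    forall p, (0 < p < L)%N -> q p y < 1].
  have /choice[w wP] x : exists i, g (T i x) = g x.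
    by have [[i _ iE] _] := g_max x; exists i.
  pose step x := T (w x) x; pose x k := iter k step ((f x1)^-1 *: x1).
  have gx k : g (x k) = C.
    elim: k => [|k IH]; last by rewrite [x _]iterS wP.
    by rewrite /x /= gZ gtr0_norm ?invr_gt0 // mulrC.
  have fx k : f (x k) = 1.
    apply/eqP; rewrite eq_le; apply/andP; split.
      elim: k => [|k IH]; last exact: le_trans (fT _ _) IH.
      by rewrite /x /= fZ gtr0_norm ?invr_gt0 // mulVf ?gt_eqF.
    by rewrite -(ler_pM2l C_gt0) mulr1 -[X in X <= _](gx k) gC.
  have [k [q0 qp]] := root_touched s_primitive root_le q_le q_attained q_step
    ltr01 (x := x) (w := fun k => w (x k)) (fun k => erefl _) fx.
  by exists (x k); split.
(* Here the choices maximize [f], which stays 1, while [g] cannot increase and so stays at most its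
   minimal ratio [c]. *)
have [z [fz gz q0z]] : exists z, [/\ f z = 1, g z <= c & q 0%N z = 1].
  have /choice[w wP] x : exists i, f (T i x) = f x.
    by have [[i _ iE] _] := f_max x; exists i.
  pose step x := T (w x) x; pose x k := iter k step ((f x2)^-1 *: x2).
  have fx k : f (x k) = 1.
    elim: k => [|k IH]; last by rewrite [x _]iterS wP.
    by rewrite /x /= fZ gtr0_norm ?invr_gt0 // mulVf ?gt_eqF.
  have gx k : g (x k) <= c.
    elim: k => [|k IH]; last exact: le_trans (gT _ _) IH.
    by rewrite /x /= gZ gtr0_norm ?invr_gt0 // mulrC.
  have [k [q0 _]] := root_touched s_primitive root_le q_le q_attained q_step
    ltr01 (x := x) (w := fun k => w (x k)) (fun k => erefl _) fx.
  by exists (x k); split.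
(* Finitely many values below 1 leave a uniform gap. *)
have [mu [mu_ge0 mu_lt1 q_mu]] : exists mu : R, [/\ 0 <= mu, mu < 1 &
    forall p, (0 < p < L)%N -> q p y <= mu].
  elim: (L) qy => [|K IH] qy; first by exists 0; split=> // p; case: p.
  have [|mu [mu0 mu1 muP]] := IH.
    by move=> p /andP[p0 pK]; apply: qy; rewrite p0 ltnW.
  have [K0|K0] := posnP K; first by exists 0; split=> // p; rewrite K0; case: p.
  exists (Num.max mu (q K y)); split; first by rewrite le_max mu0.
    by rewrite gt_max mu1 qy // K0 ltnSn.
  move=> p /andP[p0]; rewrite ltnS leq_eqVlt => /predU1P[->|pK].
    by rewrite le_max lexx orbT.
  by rewrite le_max muP // p0.
(* Half the gap: since [mu = 1 - 2 e], one has [(1 + e) mu + e = 1 - 2 e^2 <= 1], which controls the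
   sets other than [V_1]. *)
pose e := (1 - mu) / 2; have e_gt0 : 0 < e by rewrite divr_gt0 // subr_gt0.
(* [u], slightly beyond [y] as seen from [z'], is still almost in the unit ball
   of [f], because only [V_1] touches at [y]; convexity of [g] on the segment
   from [z'] to [u] concludes. *)
have key (t : R) : 0 < t -> C <= c + C * t.
  move=> t_gt0; have [z' z't z'h] := root_match q0y q0z t_gt0.
  have fz' : f z' <= 1 by rewrite -fz z'h.
  have gz' : g z' <= c by rewrite (le_trans _ gz) // z'h.
  pose u := y + e *: (y - z').
  have fu : f u <= 1 + e * t.
    have [p pL <-] := q_attained u; have [p0|p0] := posnP p.
      rewrite p0 in pL *; apply: le_trans (qD _ _ pL) _.
      by rewrite q0y qZ // gtr0_norm // lerD2l ler_wpM2l // ltW.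
    have -> : u = (1 + e) *: y + (- e) *: z'.
      by rewrite /u scalerBr scalerDl scale1r scaleNr addrA.
    apply: le_trans (qD _ _ pL) _; rewrite !qZ // normrN !gtr0_norm ?addr_gt0 //.
    have := q_mu p; rewrite p0 pL => /(_ isT).
    have := le_trans (q_le z' pL) fz'.
    have : 0 <= e * t by rewrite mulr_ge0 ?ltW.
    rewrite /e; nra.
  have : g ((1 + e) *: y) <= g u + g (e *: z').
    have -> : (1 + e) *: y = u + e *: z'.
      by rewrite /u scalerBr scalerDl scale1r -addrA subrK.
    exact: gD.
  rewrite !gZ !gtr0_norm ?addr_gt0 // gy => gu.
  rewrite -(ler_pM2l e_gt0); have := gC u; have := ler_wpM2l (ltW C_gt0) fu.
  have := ler_wpM2l (ltW e_gt0) gz'.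
  by rewrite !mulrDr; lra.
have Cc : C <= c.
  rewrite leNgt; apply/negP => cC.
  (* For this [t] the error [C * t] is half of the supposed gap [C - c]. *)
  have t0 : 0 < (C - c) / (2 * C).
    by apply: divr_gt0; [rewrite subr_gt0|apply: mulr_gt0].
  have := key _ t0.
  have -> : C * ((C - c) / (2 * C)) = (C - c) / 2 by field; rewrite gt_eqF.
  by lra.
exists C => // x; apply/eqP; rewrite eq_le gC /=.
by apply: le_trans (cg x); rewrite ler_wpM2r //; case: f_norm.
Qed.

End Uniqueness.

(** * The tree built by the algorithm *)

Section Algorithm.
Variables (R : realType) (d m : nat) (Bt : 'I_m -> 'M[R]_d) (s : seq 'I_m).
Variable V1 : set 'cV[R]_d.
Implicit Types (X : set 'cV[R]_d) (V H N : seq (set 'cV[R]_d)).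
Implicit Types (ps : seq (set 'cV[R]_d * 'I_m)).

Local Notation image i X := (apply_set (Bt i) X).

Lemma body_cat_interior V N : interior (body V) `<=` interior (body (V ++ N)).
Proof.
apply: interiorS; apply: convex_hullS; rewrite -!bigcup_seq => x [X /= XV Xx].
by exists X; rewrite //= mem_cat XV.
Qed.

(** The body only grows while pairs are processed, so a set skipped early stays in the interior at
    the end, whatever the order of the pairs. *)
Lemma processP V ps : exists N, [/\ process Bt V ps = (V ++ N, N),
  forall X, X \in N -> exists2 q, q \in ps & X = image q.2 q.1 &
  forall q, q \in ps ->
    image q.2 q.1 `<=` interior (body (V ++ N)) \/ image q.2 q.1 \in N].
Proof.
elim/last_ind: ps => [|ps q [N [pE Nps psN]]].
  by exists [::]; rewrite cats0.
rewrite /process -cats1 foldl_cat -/(process Bt V ps) pE /= /process_pair /=.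
case: asboolP => [qN|_].
  exists N; split=> // [X /Nps[q' q'ps ->]|q'].
    by exists q'; rewrite // mem_cat q'ps.
  by rewrite mem_cat inE => /orP[/psN//|/eqP ->]; left.
exists (rcons N (image q.2 q.1)); rewrite rcons_cat; split=> //.
  move=> X; rewrite mem_rcons inE => /predU1P[->|/Nps[q' q'ps ->]].
    by exists q; rewrite // mem_cat mem_head orbT.
  by exists q'; rewrite // mem_cat q'ps.
move=> q'; rewrite mem_cat inE => /orP[/psN[q'N|q'N]|/eqP ->].
- by left; rewrite -cats1 catA; apply: subset_trans q'N _; exact: body_cat_interior.
- by right; rewrite mem_rcons inE q'N orbT.
- by right; rewrite mem_rcons mem_head.
Qed.

(** Members are addressed by index because a set may occur repeatedly; the strict growth [p < p'] is
    what makes the descent in [root_touched] finite. *)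
Definition resolved V p i :=
  [\/ image i (nth set0 V p) `<=` interior (body V),
      (p < size s)%N /\ i = nth i s p |
      exists p', [/\ (size s <= p')%N, (p < p' < size V)%N &
                     nth set0 V p' = image i (nth set0 V p)]].

(** The loop invariant: all pairs from [V'] are settled and [H] is still to be processed, so at
    termination every pair is settled. The last clause supports induction along parents. *)
Definition tree_state V H := exists V',
  [/\ V = V' ++ H, exists W, V = root_sets Bt s V1 ++ W,
      forall p i, (p < size V')%N -> resolved V p i &
      forall p, (size s <= p < size V)%N -> exists p' i,
        (p' < p)%N /\ nth set0 V p = image i (nth set0 V p')].

Lemma size_root_sets : size (root_sets Bt s V1) = size s.
Proof. by rewrite size_map size_iota. Qed.

(** The list of pairs is abstract so that one argument serves both the first iteration, with its
    excluded pairs, and all later ones. *)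
Lemma tree_state_next V H ps : tree_state V H ->
  {subset [seq q.1 | q <- ps] <= H} ->
  (forall p i, (p < size V)%N -> nth set0 V p \in H -> (nth set0 V p, i) \in ps \/
     (p < size s)%N /\ i = nth i s p) ->
  tree_state (process Bt V ps).1 (process Bt V ps).2.
Proof.
move=> [V' [VE [W WE] resV' parentV]] psH Hps.
have [N [-> Nps psN] /=] := processP V ps.
have sV : (size s <= size V)%N by rewrite WE size_cat size_root_sets leq_addr.
exists V; split=> //; first by exists (W ++ N); rewrite catA -WE.
  move=> p i pV.
  have [pV'|pV'] := ltnP p (size V').
    rewrite /resolved nth_cat pV.
    have [int|[sp i_p]|[p' [sp' /andP[pp' p'V] p'E]]] := resV' p i pV'.
    - by apply: Or31; apply: subset_trans int _; exact: body_cat_interior.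
    - by apply: Or32.
    - apply: Or33; exists p'; rewrite nth_cat p'V p'E; split=> //.
      by rewrite pp' size_cat ltn_addr.
  have pH : nth set0 V p \in H.
    rewrite VE nth_cat ltnNge pV' mem_nth // -(ltn_add2r (size V')) subnK //.
    by rewrite addnC -size_cat -VE.
  rewrite /resolved nth_cat pV.
  have [/psN/=[int|pN]|ex] := Hps p i pV pH; [exact: Or31| |exact: Or32].
  have iN : (index (image i (nth set0 V p)) N < size N)%N by rewrite index_mem.
  apply: Or33; exists (size V + index (image i (nth set0 V p)) N)%N; split.
  - exact: leq_trans sV (leq_addr _ _).
  - by rewrite size_cat ltn_add2l iN andbT ltn_addr.
  - by rewrite nth_cat ltnNge leq_addr /= addKn nth_index.
move=> p; rewrite size_cat => /andP[sp pVN]; rewrite nth_cat.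
have [pV|Vp] := ltnP p (size V).
  have [|p' [i [p'p pE]]] := parentV p; first by rewrite sp.
  by exists p', i; rewrite nth_cat (ltn_trans p'p pV).
have : nth set0 N (p - size V) \in N by rewrite mem_nth // ltn_subLR.
move=> /Nps[q qps ->]; have qH : q.1 \in H by apply: psH; apply: map_f.
have qV : q.1 \in V by rewrite VE mem_cat qH orbT.
exists (index q.1 V), q.2; split; first by apply: leq_trans Vp; rewrite index_mem.
by rewrite nth_cat index_mem qV nth_index.
Qed.

Lemma algorithm_tree_state k V H : algorithm_state Bt s V1 k V H -> tree_state V H.
Proof.
have root_state : tree_state (root_sets Bt s V1) (root_sets Bt s V1).
  exists [::]; split=> //; first by exists [::]; rewrite cats0.
  by move=> p; rewrite size_root_sets => /andP[/leq_ltn_trans/[apply]]; rewrite ltnn.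
elim=> [//|ps /perm_mem psE|{}k {}V {}H ps _ IH _ /perm_mem psE].
  apply: (tree_state_next root_state).
    move=> _ /mapP[q + ->]; rewrite psE => /flattenP[_ /mapP[p pzip ->]] /mapP[i _ ->] /=.
    case: p pzip => X j /(map_f fst) /=; rewrite -/unzip1 unzip1_zip //.
    by rewrite size_root_sets.
  move=> p i; rewrite size_root_sets => ps' _; rewrite psE.
  have [->|ip] := eqVneq i (nth i s p); first by right; split=> //; exact: set_nth_default.
  left; apply/flattenP; eexists.
    apply/mapP; exists (nth (set0, i) (zip (root_sets Bt s V1) s) p); last reflexivity.
    by rewrite mem_nth // size_zip size_root_sets minnn.
  rewrite nth_zip ?size_root_sets //=; apply/mapP; exists i => //.
  by rewrite mem_filter ip mem_enum.
apply: (tree_state_next IH).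
  by move=> _ /mapP[q + ->]; rewrite psE => /allpairsP[[X i] [/= XH _ ->]].
move=> p i _ pH; left; rewrite psE; apply/allpairsP.
by exists (nth set0 V p, i); rewrite mem_enum.
Qed.

Lemma nth_root_sets V W p : V = root_sets Bt s V1 ++ W -> (p < size s)%N ->
  nth set0 V p = apply_set (word_prod Bt (take p s)) V1.
Proof.
move=> -> ps; rewrite nth_cat size_root_sets ps (nth_map 0%N) ?size_iota //.
by rewrite nth_iota.
Qed.

Lemma apply_set_comp (M1 M2 : 'M[R]_d) X :
  apply_set M1 (apply_set M2 X) = apply_set (M1 *m M2) X.
Proof.
by rewrite /apply_set image_comp; apply: eq_imagel => x _ /=; rewrite mulmxA.
Qed.

Lemma apply_set1 X : apply_set 1%:M X = X.
Proof.
apply/seteqP; split=> [_ [x Xx <-]|x Xx]; rewrite ?mul1mx //.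
by exists x; rewrite ?mul1mx.
Qed.

(** The excluded pairs only run along the root; it closes into a cycle because the whole product
    maps [V1] onto itself. *)
Lemma next_root_set V W p i : V = root_sets Bt s V1 ++ W ->
  apply_set (word_prod Bt s) V1 = V1 -> (p < size s)%N -> i = nth i s p ->
  nth set0 V (p.+1 %% size s) = image i (nth set0 V p).
Proof.
move=> VE cycle ps iE; have s_gt0 : (0 < size s)%N by apply: leq_ltn_trans ps.
rewrite !(nth_root_sets VE) ?ltn_pmod // apply_set_comp.
have -> : Bt i *m word_prod Bt (take p s) = word_prod Bt (take p.+1 s).
  by rewrite (take_nth i ps) word_prod_rcons -iE.
move: ps; rewrite leq_eqVlt => /predU1P[->|ps]; last by rewrite modn_small.
by rewrite modnn take0 apply_set1 take_size cycle.
Qed.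

End Algorithm.

(** * Irrational rotations *)

Section Rotations.
Variable R : realType.
Implicit Types (x t e phi : R).

(** Pigeonhole: the fractional parts of [N + 2] multiples of [x] fall into [N + 1] cells of length
    [1 / (N + 1)], and two that share a cell are subtracted. *)
Lemma dirichlet_approx x (N : nat) : exists (k : nat) (l : int),
  (0 < k)%N /\ `|k%:R * x - l%:~R| < N.+1%:R^-1.
Proof.
pose fr (q : nat) := q%:R * x - (Num.floor (q%:R * x))%:~R.
have fr_itv q : 0 <= fr q < 1.
  by have := floor_itv (q%:R * x); rewrite intrD /fr; lra.
pose cell (q : 'I_N.+2) : 'I_N.+1 := inord (Num.truncn (N.+1%:R * fr q)).
have Nfr_ge0 q : 0 <= N.+1%:R * fr q by rewrite mulr_ge0 //; case/andP: (fr_itv q).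
have N_gt0 : 0 < N.+1%:R :> R by rewrite ltr0n.
have cellE (q : 'I_N.+2) : (cell q)%:R <= N.+1%:R * fr q < (cell q)%:R + 1.
  have itv := truncn_itv (Nfr_ge0 q); rewrite natr1 inordK //.
  rewrite -(ltr_nat R); case/andP: itv => /le_lt_trans-> //.
  by rewrite gtr_pMr //; case/andP: (fr_itv q).
have /injectivePn[q1 [q2 q12 cellq]] : ~~ injectiveb cell.
  by apply/negP => /injectiveP/leq_card; rewrite !card_ord ltnn.
wlog lt12 : q1 q2 q12 cellq / (q1 < q2)%N.
  move=> H; have [lt12|lt21|/val_inj eq12] := ltngtP q1 q2.
  - exact: H lt12.
  - by apply: (H q2 q1) => //; rewrite eq_sym.
  - by rewrite eq12 eqxx in q12.
exists (q2 - q1)%N, (Num.floor (q2%:R * x) - Num.floor (q1%:R * x)).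
rewrite subn_gt0 lt12; split=> //.
have -> : (q2 - q1)%:R * x - (Num.floor (q2%:R * x) - Num.floor (q1%:R * x))%:~R =
    fr q2 - fr q1 by rewrite natrB 1?ltnW // intrB /fr; ring.
rewrite -[ltRHS]mul1r ltr_pdivlMr // -[X in _ * X](gtr0_norm N_gt0) -normrM.
have := cellE q1; have := cellE q2; rewrite cellq ltr_norml mulrBl !(mulrC _ N.+1%:R).
lra.
Qed.

(** Dirichlet's approximation gives a small step [psi], nonzero by irrationality; its multiples pass
    within [|psi|] of every target. *)
Lemma irrational_rotation_dense x t e : irrational x -> 0 < e ->
  exists (n : nat) (l : int), `|t - n%:R * x - l%:~R| < e.
Proof.
move=> x_irr e_gt0.
have [N Ne] : exists N : nat, N.+1%:R^-1 < e.
  exists (Num.truncn e^-1); rewrite -[ltRHS]invrK ltf_pV2 ?posrE ?invr_gt0 ?ltr0n //.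
  have e1_ge0 : 0 <= e^-1 by rewrite invr_ge0 ltW.
  by have /andP[] := truncn_itv e1_ge0.
have [k [l [k_gt0 kl]]] := dirichlet_approx x N.
set psi := k%:R * x - l%:~R in kl; have {}kl := lt_trans kl Ne.
have psi0 : psi != 0.
  apply/eqP => psi0; apply: x_irr; apply/rationalP; exists l, k.
  by apply/(canRL (mulfK _)); [rewrite pnatr_eq0 -lt0n|apply/eqP; rewrite mulrC -subr_eq0 -/psi psi0].
(* An integer shift with the sign of [psi], large enough that the number of steps towards the target
   is nonnegative. *)
pose L : int := (-1) ^+ (psi < 0)%R * (Num.truncn `|t|).+1%:Z.
have Lt : `|t| < (Num.truncn `|t|).+1%:R.
  by have /andP[] := truncn_itv (normr_ge0 t).
have quot_ge0 : 0 <= (t + L%:~R) / psi.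
  rewrite /L intrM; have [psi_lt0|psi_gt0] := ltrP psi 0.
    rewrite ler_ndivlMr // mul0r expr1 mulrN1z mulN1r.
    by have := ler_norm t; lra.
  rewrite expr0 mul1r divr_ge0 //.
  by have := ler_norm (- t); rewrite normrN; lra.
set n := Num.truncn ((t + L%:~R) / psi).
have n_itv := truncn_itv quot_ge0; rewrite -/n in n_itv.
exists (n * k)%N, (- L - n%:Z * l).
have -> : t - (n * k)%:R * x - (- L - n%:Z * l)%:~R = ((t + L%:~R) / psi - n%:R) * psi.
  rewrite mulrBl divfK // natrM !(intrD, mulrNz, intrM) /psi pmulrn; ring.
rewrite normrM; apply: le_lt_trans kl; rewrite ler_piMl // ler_norml.
by move: n_itv => /andP[]; rewrite -natr1; lra.
Qed.

Lemma cos_int_period x (l : int) : cos (x + l%:~R * (pi *+ 2)) = cos x.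
Proof.
have pos (n : nat) (y : R) : cos (y + n%:R * (pi *+ 2)) = cos y.
  by rewrite mulr_natl periodicn //; exact: cosD2pi.
case: l => n; first exact: pos.
by rewrite NegzE mulrNz mulNr -[LHS](pos n.+1) subrK.
Qed.

Lemma irrational_rotation_cos phi t e : irrational (phi / pi) -> 0 < e ->
  exists n : nat, 1 - e < cos (t - n%:R * phi).
Proof.
move=> phi_irr e_gt0.
have pi2 : 0 < (pi : R) *+ 2 by rewrite mulrn_wgt0 // pi_gt0.
have /cvgrPdist_lt/(_ _ e_gt0)/nbhs_ballP[r /= r_gt0 cosr] := @continuous_cos R 0.
(* The cosine has period [2 pi], so the rotation number is [phi / (2 pi)]. *)
have irr2 : irrational (phi / (pi *+ 2)).
  apply: contra_not phi_irr => /rationalP[a [b abE]]; apply/rationalP.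
  exists (a * 2), b; rewrite intrM mulrAC -abE.
  by rewrite -[pi *+ 2]mulr_natr invfM mulrA divfK.
have [n [l nl]] := irrational_rotation_dense (t / (pi *+ 2)) irr2 (divr_gt0 r_gt0 pi2).
exists n; rewrite -(cos_int_period _ (- l)).
have : ball 0 r (t - n%:R * phi + (- l)%:~R * (pi *+ 2)).
  rewrite -ball_normE /= sub0r normrN.
  rewrite ltr_pdivlMr // -[X in _ * X](gtr0_norm pi2) -normrM in nl.
  rewrite (le_lt_trans _ nl) // le_eqVlt; apply/orP; left; apply/eqP; congr `| _ |.
  rewrite mulrNz; move: (pi *+ 2) pi2 => p p_gt0; field; by rewrite gt_eqF.
by move=> /cosr; rewrite cos0 ltr_norml; lra.
Qed.

Lemma unit_circle_angle (u v : R) : u ^+ 2 + v ^+ 2 = 1 ->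
  exists t, u = cos t /\ v = sin t.
Proof.
move=> uv; have u1 : -1 <= u <= 1.
  by have v2 := sqr_ge0 v; apply/andP; split; nra.
have := sin_acos u1; have -> : 1 - u ^+ 2 = v ^+ 2 by rewrite -uv addrC addKr.
rewrite sqrtr_sqr => sinE; have [v0|v0] := lerP 0 v.
  by exists (acos u); rewrite acosK ?in_itv // sinE ger0_norm.
by exists (- acos u); rewrite cosN sinN acosK ?in_itv // sinE ltr0_norm // opprK.
Qed.

End Rotations.

(** * The leading eigenvalue *)

Section StartingSet.
Variables (R : realType) (d : nat).
Implicit Types (P : 'M[R]_d) (l : complex R) (a b v : 'cV[R]_d).

Lemma eigenvalue_dim_gt0 P l : eigenvalue (cplx_mx P) l -> (0 < d)%N.
Proof.
move=> /eigenvalueP[v _ v0]; rewrite lt0n; apply: contra v0 => /eqP d0.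
by apply/eqP/rowP => j; move: (ltn_ord j); rewrite [X in (_ < X)%N]d0.
Qed.

Lemma sqr_normc l : Normc.normc l ^+ 2 = complex.Re l ^+ 2 + complex.Im l ^+ 2.
Proof. by case: l => a b; rewrite /Normc.normc sqr_sqrtr // addr_ge0 ?sqr_ge0. Qed.

Lemma cplx_mulmx_col P a b : cplx_mx P *m cplx_col a b = cplx_col (P *m a) (P *m b).
Proof.
apply/colP => j; rewrite !mxE.
elim/big_rec3 : _ => [//|k x y z _ ->]; by rewrite !mxE; simpc.
Qed.

(** A real eigenvalue of modulus 1 is 1 or -1, which fixes or swaps [v] and [- v]. *)
Lemma starting_set_real P l (V1 : set 'cV[R]_d) : starting_set P l V1 -> Normc.normc l = 1 ->
  complex.Im l = 0 -> exists v,
  [/\ V1 = [set v; - v], v != 0 & apply_set P V1 = V1].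
Proof.
move=> [_ +] l1 b0; rewrite b0 eqxx => -[v [v0 Pv ->]].
exists v; split=> //; rewrite apply_pair Pv.
have : complex.Re l ^+ 2 = 1 by have := sqr_normc l; rewrite l1 b0 expr1n expr0n addr0.
move=> /eqP; rewrite sqrf_eq1 => /orP[] /eqP ->; rewrite ?scale1r ?scaleN1r ?opprK //.
by rewrite setUC.
Qed.

(** In the coordinates of [a] and [b], multiplication by an eigenvalue of modulus 1 is a rotation,
    which maps the unit circle onto itself. *)
Lemma starting_set_nonreal P l (V1 : set 'cV[R]_d) : 
  starting_set P l V1 -> Normc.normc l = 1 -> complex.Im l != 0 -> exists a b,
  [/\ V1 = Phi a b (@unit_circle R), (a != 0) || (b != 0),
      P *m a = complex.Re l *: a - complex.Im l *: b,
      P *m b = complex.Im l *: a + complex.Re l *: b & apply_set P V1 = V1].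
Proof.
move=> [_ +] l1 i0; rewrite (negPf i0) => -[a [b [ab0 Pab ->]]].
have := sqr_normc l; rewrite l1 expr1n => /esym.
case: l Pab {i0 l1} => r i /= Pab ri1.
have [Pa Pb] : P *m a = r *: a - i *: b /\ P *m b = i *: a + r *: b.
  have E j : Complex ((P *m a) j 0) ((P *m b) j 0) =
      Complex (r * a j 0 - i * b j 0) (r * b j 0 + i * a j 0).
    by have /matrixP/(_ j 0) := Pab; rewrite cplx_mulmx_col !mxE.
  by split; apply/colP => j; have [] := E j; rewrite !mxE // addrC => _ ->; rewrite addrC.
exists a, b; split=> //.
  apply: contraNT ab0; rewrite negb_or !negbK => /andP[/eqP -> /eqP ->].
  by apply/eqP/colP => j; rewrite !mxE.
rewrite apply_Phi Pa Pb; apply/seteqP; split=> _ [[u v] /= uv <-].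
  exists (u * r + v * i, v * r - u * i).
    rewrite /unit_circle /= in uv *; rewrite -[RHS](mulr1 1) -{1}uv -ri1; ring.
  by apply/colP => j; rewrite !mxE /=; ring.
exists (u * r - v * i, v * r + u * i).
  rewrite /unit_circle /= in uv *; rewrite -[RHS](mulr1 1) -{1}uv -ri1; ring.
by apply/colP => j; rewrite !mxE /= -[u in RHS]mulr1 -[v in RHS]mulr1 -ri1; ring.
Qed.

End StartingSet.

Section NormalizedProduct.
Variables (R : realType) (d m : nat) (B : 'I_m -> 'M[R]_d) (s : seq 'I_m).
Variable lambda : complex R.
Hypothesis s_neq0 : s <> [::].
Hypothesis nu_gt0 : 0 < nu B s.
Hypothesis leading : leading_eigenvalue (word_prod B s) lambda.

Lemma normc_leading : Normc.normc lambda = nu B s ^+ size s.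
Proof.
have [eig ge] := leading.
have sr : spectral_radius (word_prod B s) = Normc.normc lambda.
  apply: is_max_sup; split; first by exists lambda.
  by move=> _ [l' /ge le <-].
have n0 : (size s)%:R != 0 :> R by rewrite pnatr_eq0 size_eq0; apply/eqP.
have sr_ge0 : 0 <= Normc.normc lambda by case: (lambda) => a b; exact: sqrtr_ge0.
by rewrite /nu sr -powR_mulrn ?powR_ge0 // -powRrM mulVf // powRr1.
Qed.

Lemma normalized_eigenvalueE :
  real_complex R (nu B s ^- size s) * lambda =
  Complex (nu B s ^- size s * complex.Re lambda) (nu B s ^- size s * complex.Im lambda).
Proof.
case: lambda => a b; rewrite /real_complex_def /=; simpc.
by [].
Qed.

Lemma normc_normalized :
  Normc.normc (real_complex R (nu B s ^- size s) * lambda) = 1.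
Proof.
rewrite Normc.normcM normc_leading.
rewrite /Normc.normc /= expr0n addr0 sqrtr_sqr ger0_norm ?invr_ge0 ?exprn_ge0 ?ltW //.
by rewrite mulVf // expf_neq0 // gt_eqF.
Qed.

End NormalizedProduct.

(** * The norm of the final body *)

Section Subspaces.
Variables (R : realType) (d : nat).

(** A subspace of maximal dimension inside [Q] exhausts it, since otherwise a line could be
    adjoined. This turns the kernel of [f] into a [vspace] to which irreducibility applies. *)
Lemma vspace_of_set (Q : set 'cV[R]_d) : Q 0 ->
  (forall (c : R) x y, Q x -> Q y -> Q (c *: x + y)) ->
  exists W : {vspace 'cV[R]_d}, forall x, x \in W <-> Q x.
Proof.
move=> Q0 QD; have QZ (c : R) x : Q x -> Q (c *: x).
  by move=> Qx; rewrite -[_ *: _]addr0; apply: QD.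
pose S n := `[< exists W : {vspace 'cV[R]_d}, (forall x, x \in W -> Q x) /\ \dim W = n >].
have exS : exists n, S n.
  exists 0%N; apply/asboolP; exists 0%VS; rewrite dimv0; split=> // x.
  by rewrite memv0 => /eqP ->.
have leS n : S n -> (n <= \dim {: 'cV[R]_d})%N.
  by move=> /asboolP[W [_ <-]]; apply: dimvS; exact: subvf.
case: (ex_maxnP exS leS) => n /asboolP[W [WQ dimW]] max.
exists W => x; split=> [/WQ //|Qx]; have [//|xW] := boolP (x \in W).
have /max : S (\dim (W + <[x]>)).
  apply/asboolP; exists (W + <[x]>)%VS; split=> // _ /memv_addP[w wW [_ /vlineP[c ->] ->]].
  by rewrite addrC; apply: QD => //; apply: WQ.
rewrite -dimW leqNgt => /negP[].
rewrite ltn_neqAle dimvS ?addvSl // andbT; apply: contra xW => dimE.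
have /eqP -> : W == (W + <[x]>)%VS by rewrite eqEdim addvSl (eqP dimE) /=.
by apply: (subvP (addvSr W <[x]>%VS)); exact: memv_line.
Qed.

End Subspaces.

(** * Piecewise-linear and piecewise-quadratic maxima *)

Section Pieces.
Variables (R : realType) (d : nat).
Implicit Types (f : 'cV[R]_d -> R).

(** The piece of [u] is the cone on which [u] beats every other generator. *)
Lemma piecewise_linear_max (F : seq 'cV[R]_d) f :
  (forall x, exists2 u, u \in F & dotp u x = f x) ->
  (forall u x, u \in F -> dotp u x <= f x) -> piecewise_linear f.
Proof.
move=> f_att f_ge; exists [seq ([seq u - w | w <- F], u) | u <- F] => /=; split.
  move=> x; have [u uF uE] := f_att x.
  exists ([seq u - w | w <- F], u); first exact: map_f.
  by move=> _ /mapP[w wF ->]; rewrite dotpDl dotpNl uE subr_ge0 f_ge.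
move=> _ x /mapP[u uF ->] /= cone; apply/eqP; rewrite eq_le f_ge // andbT.
have [w wF <-] := f_att x; have := cone (u - w) (map_f _ wF).
by rewrite dotpDl dotpNl subr_ge0.
Qed.

Definition sum_sqr_mx (p : 'cV[R]_d * 'cV[R]_d) := p.1 *m p.1^T + p.2 *m p.2^T.

Lemma qform_sum_sqr p x :
  qform (sum_sqr_mx p) x = dotp p.1 x ^+ 2 + dotp p.2 x ^+ 2.
Proof.
have E (u : 'cV[R]_d) : dotp x (u *m u^T *m x) = dotp u x ^+ 2.
  by rewrite -mulmxA [u^T *m x]mx11_scalar -dotpE mul_mx_scalar dotpZr dotpC.
by rewrite /qform /sum_sqr_mx mulmxDl dotpDr !E.
Qed.

Lemma qformB (S S' : 'M[R]_d) x : qform (S - S') x = qform S x - qform S' x.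
Proof. by rewrite /qform mulmxBl dotpDr dotpNr. Qed.

Lemma piecewise_quadratic_max (F : seq ('cV[R]_d * 'cV[R]_d)) f :
  (forall x, exists2 p, p \in F & Num.sqrt (dotp p.1 x ^+ 2 + dotp p.2 x ^+ 2) = f x) ->
  (forall p x, p \in F -> Num.sqrt (dotp p.1 x ^+ 2 + dotp p.2 x ^+ 2) <= f x) ->
  piecewise_quadratic f.
Proof.
move=> f_att f_ge.
have q_ge0 p x : 0 <= qform (sum_sqr_mx p) x.
  by rewrite qform_sum_sqr addr_ge0 ?sqr_ge0.
exists [seq ([seq sum_sqr_mx p - sum_sqr_mx p' | p' <- F], sum_sqr_mx p) | p <- F] => /=.
split.
  move=> x; have [p pF pE] := f_att x.
  exists ([seq sum_sqr_mx p - sum_sqr_mx p' | p' <- F], sum_sqr_mx p).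
    exact: (map_f (fun p => ([seq sum_sqr_mx p - sum_sqr_mx p' | p' <- F], sum_sqr_mx p))).
  move=> _ /mapP[p' p'F ->]; rewrite qformB subr_ge0 -ler_psqrt ?nnegrE ?q_ge0 //.
  by rewrite !qform_sum_sqr pE f_ge.
move=> _ x /mapP[p pF ->] /= region; split=> //.
apply/eqP; rewrite eq_le qform_sum_sqr f_ge // andbT.
have [p' p'F <-] := f_att x; have := region _ (map_f _ p'F).
by rewrite qformB subr_ge0 !qform_sum_sqr => /ler_wsqrtr.
Qed.

End Pieces.

Section FinalBody.
Variables (R : realType) (d m : nat) (A : 'I_m -> 'M[R]_d) (s : seq 'I_m).
Variables (V1 : set 'cV[R]_d) (V : seq (set 'cV[R]_d)).
Let B := transpose_family A.
Let Bt := normalized B s.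
Hypothesis d_gt0 : (0 < d)%N.
Hypothesis A_irr : irreducible_family A.
Hypothesis s_primitive : primitive_word s.
Hypothesis nu_gt0 : 0 < nu B s.
Hypothesis final : tree_state Bt s V1 V [::].
Hypothesis cycle : apply_set (word_prod Bt s) V1 = V1.
Hypothesis V1_elliptic : elliptic V1.
Hypothesis V1_neq0 : exists2 v, V1 v & v != 0.

Lemma resolved_final p i : (p < size V)%N -> resolved Bt s V p i.
Proof. by have [V' [+ _ res _]] := final; rewrite cats0 => VE pV; apply: res; rewrite -VE. Qed.

Lemma root_le_size : (size s <= size V)%N.
Proof. by have [_ [_ [W ->] _ _]] := final; rewrite size_cat size_root_sets leq_addr. Qed.

Lemma size_s_gt0 : (0 < size s)%N.
Proof. by rewrite lt0n size_eq0; apply/eqP; case: s_primitive. Qed.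

Lemma final_next_root p i : (p < size s)%N -> i = nth i s p ->
  nth set0 V (p.+1 %% size s) = apply_set (Bt i) (nth set0 V p).
Proof. by have [_ [_ [W VE] _ _]] := final => ps; apply: next_root_set VE cycle ps. Qed.

Lemma nth_final0 : nth set0 V 0 = V1.
Proof.
have [_ [_ [W VE] _ _]] := final.
by rewrite (nth_root_sets VE size_s_gt0) take0 apply_set1.
Qed.

Lemma final_ind (K : set 'cV[R]_d -> Prop) : K V1 ->
  (forall M X, K X -> K (apply_set M X)) -> forall X, X \in V -> K X.
Proof.
move=> KV1 KM X XV; rewrite -(nth_index set0 XV).
have := XV; rewrite -index_mem.
have [_ [_ [W VE] _ parent]] := final.
elim/ltn_ind: (index X V) => p IH pV.
have [ps|sp] := ltnP p (size s); first by rewrite (nth_root_sets VE ps); apply: KM.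
have [|p' [i [p'p ->]]] := parent p; first by rewrite sp.
by apply: KM; apply: IH => //; apply: ltn_trans pV.
Qed.

Lemma final_elliptic : all_elliptic V.
Proof. by apply: final_ind => // M X; exact: elliptic_apply. Qed.

(** A root set is the image of its predecessor on the cycle, any other member that of its parent in
    the tree. This makes the maximum in [final_max] attained. *)
Lemma final_parent p : (p < size V)%N -> exists p' i,
  (p' < size V)%N /\ nth set0 V p = apply_set (Bt i) (nth set0 V p').
Proof.
move=> pV; have [_ [_ _ _ parent]] := final.
have [ps|sp] := ltnP p (size s); last first.
  have [|p' [i [p'p pE]]] := parent p; first by rewrite sp.
  by exists p', i; split=> //; apply: ltn_trans pV.
have [i0 _] : exists i0 : 'I_m, True.
  by case sE : s => [|i0 s']; [move: size_s_gt0; rewrite sE|exists i0].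
(* Adding [(size s).-1] modulo [size s] steps back by one, also from index 0. *)
have prev_lt : ((p + (size s).-1) %% size s < size s)%N by rewrite ltn_pmod ?size_s_gt0.
exists ((p + (size s).-1) %% size s)%N, (nth i0 s ((p + (size s).-1) %% size s)).
split; first exact: leq_trans prev_lt root_le_size.
rewrite -final_next_root //; last exact: set_nth_default.
congr (nth _ _ _); rewrite -addn1 modnDml addn1 -addnS prednK ?size_s_gt0 //.
by rewrite modnDr modn_small.
Qed.

Lemma V_neq_nil : V <> [::].
Proof. by move=> V0; have := root_le_size; rewrite V0 leqNgt size_s_gt0. Qed.

(** This is [A i] divided by [nu B s], written as the dual of the action of [Bt i] on sets. *)
Definition scaled_action i (x : 'cV[R]_d) : 'cV[R]_d := (Bt i)^T *m x.

Lemma scaled_actionE i x : A i *m x = nu B s *: scaled_action i x.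
Proof.
rewrite /scaled_action /Bt /normalized linearZ /= trmxK -scalemxAl scalerA.
by rewrite mulfV ?scale1r // gt_eqF.
Qed.

Let f := maxsupp V.
Let q p := supp (nth set0 V p).

Lemma nth_elliptic p : (p < size V)%N -> elliptic (nth set0 V p).
Proof. by move=> pV; apply: final_elliptic; exact: mem_nth. Qed.

Lemma q_le_f p x : (p < size V)%N -> q p x <= f x.
Proof. by move=> pV; apply: supp_le_max; exact: mem_nth. Qed.

Lemma f_attained x : exists2 p, (p < size V)%N & q p x = f x.
Proof.
have [X XV XE] := maxsupp_attained x V_neq_nil final_elliptic.
by exists (index X V); rewrite /q ?index_mem ?nth_index.
Qed.

Lemma final_q_step p i x : (p < size V)%N -> 0 < f x ->
  [\/ q p (scaled_action i x) < f x,
      [/\ (p < size s)%N, i = nth i s p &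
          q (p.+1 %% size s)%N x = q p (scaled_action i x)] |
      exists p', [/\ (size s <= p')%N, (p < p' < size V)%N &
                     q p' x = q p (scaled_action i x)]].
Proof.
move=> pV fx; rewrite /q /scaled_action -supp_apply.
have [int|[ps iE]|[p' [sp' pp' p'E]]] := resolved_final i pV.
- apply: Or31; have := supp_attained x (elliptic_apply (Bt i) (nth_elliptic pV)).
  move=> [u /int uV <-]; apply: interior_dotp_lt => //; first exact: final_elliptic.
  apply: contraTneq fx => ->.
  by rewrite /f -(scale0r (0 : 'cV_d)) maxsuppZ ?normr0 ?mul0r ?ltxx //; exact: final_elliptic.
- by apply: Or32; rewrite (final_next_root ps iE).
- by apply: Or33; exists p'; rewrite p'E.
Qed.

Lemma final_max x : is_max (range (fun i => f (scaled_action i x))) (f x).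
Proof.
have le i : f (scaled_action i x) <= f x.
  have [p pV <-] := f_attained (scaled_action i x).
  (* Definiteness of [f] is proved only later, from this lemma; where [f x] is 0 the weak bound over
     the body replaces the strict one. *)
  have [fx0|fx] := lerP (f x) 0; last first.
    have [/ltW //|[ps _ <-]|[p' [_ /andP[_ p'V] <-]]] := final_q_step i pV fx.
      by apply: q_le_f; rewrite (leq_trans _ root_le_size) // ltn_pmod ?size_s_gt0.
    exact: q_le_f.
  rewrite /q /scaled_action -supp_apply.
  have [int|[ps iE]|[p' [sp' /andP[_ p'V] <-]]] := resolved_final i pV.
  - have [u /int/interior_subset uV <-] :=
      supp_attained x (elliptic_apply (Bt i) (nth_elliptic pV)).
    exact: body_dotp_le final_elliptic uV.
  - rewrite -(final_next_root ps iE); apply: q_le_f.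
    by rewrite (leq_trans _ root_le_size) // ltn_pmod ?size_s_gt0.
  - exact: q_le_f.
split; last by move=> _ [i _ <-].
have [p pV fx] := f_attained x; have [p' [i [p'V pE]]] := final_parent pV.
exists i => //; apply/eqP; rewrite eq_le le -fx /q pE supp_apply.
exact: q_le_f.
Qed.

(** The kernel of [f] is invariant under every [A i], hence trivial or everything; a nonzero [v] in
    [V1] has [f v >= dotp v v > 0], which rules out the latter. *)
Lemma final_norm : is_norm f.
Proof.
have ell := final_elliptic.
split; [exact: maxsupp_ge0| |by move=> c x; exact: maxsuppZ|by move=> x y; exact: maxsuppD].
have f0 : f 0 = 0 by rewrite -(scale0r (0 : 'cV_d)) /f maxsuppZ // normr0 mul0r.
have [||W WP] := @vspace_of_set R d [set x | f x = 0].
- exact: f0.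
- move=> c x y /= fx fy; apply/eqP; rewrite eq_le maxsupp_ge0 andbT.
  by rewrite (le_trans (maxsuppD _ _ ell)) // maxsuppZ // -/f fx fy mulr0 addr0.
have [|W0|Wf] := @A_irr W.
- move=> i x /WP /= fx; apply/WP; rewrite /= scaled_actionE /f maxsuppZ // -/f.
  suff -> : f (scaled_action i x) = 0 by rewrite mulr0.
  apply/eqP; rewrite eq_le maxsupp_ge0 andbT -fx.
  by have [_] := final_max x; apply; exists i.
- by move=> x fx; apply/eqP; rewrite -memv0 -W0; apply/WP.
have [v V1v v0] := V1_neq0.
have /WP /= fv : v \in W by rewrite Wf memvf.
have := dotp_gt0 v0; rewrite ltNge -fv.
have vV : V1 \in V by rewrite -nth_final0 mem_nth // (leq_trans size_s_gt0 root_le_size).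
by rewrite (le_trans (dotp_le_supp v V1_elliptic V1v) (supp_le_max v vV)).
Qed.

Lemma final_jsr : jsr A = nu B s.
Proof.
apply: (jsr_extremal d_gt0 nu_gt0 final_norm) => x.
have [[i _ iE] ub] := final_max x; have [_ _ fZ _] := final_norm.
split; first by exists i => //; rewrite scaled_actionE fZ gtr0_norm // iE.
move=> _ [j _ <-]; rewrite scaled_actionE fZ gtr0_norm // ler_wpM2l ?(ltW nu_gt0) //.
by apply: ub; exists j.
Qed.

Lemma is_max_scaled g x : is_norm g ->
  is_max (range (fun i => g (A i *m x))) (jsr A * g x) <->
  is_max (range (fun i => g (scaled_action i x))) (g x).
Proof.
move=> [_ _ gZ _]; have gE i : g (A i *m x) = nu B s * g (scaled_action i x).
  by rewrite scaled_actionE gZ gtr0_norm.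
rewrite final_jsr; split=> -[[i _ iE] ub]; split.
- by exists i => //; apply: (mulfI (lt0r_neq0 nu_gt0)); rewrite -gE.
- by move=> _ [j _ <-]; rewrite -(ler_pM2l nu_gt0) -gE; apply: ub; exists j.
- by exists i; rewrite // gE iE.
- by move=> _ [j _ <-]; rewrite gE ler_pM2l //; apply: ub; exists j.
Qed.

Lemma final_barabanov : barabanov A f.
Proof. by split=> [|x]; [exact: final_norm|apply/is_max_scaled; [exact: final_norm|exact: final_max]]. Qed.

Lemma final_unique :
  (forall y z (e : R), supp V1 y = 1 -> supp V1 z = 1 -> 0 < e ->
    exists2 z', supp V1 (y - z') <= e & forall h, is_norm h ->
      (forall i x, h (scaled_action i x) <= h x) -> h z' <= h z) ->
  unique_barabanov A f.
Proof.
move=> match_root g [g_norm g_max].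
apply: (extremal_norm_unique (T := scaled_action) (q := q) d_gt0 s_primitive root_le_size
  final_norm final_max) => //.
- by move=> p c x pV; apply: suppZ; exact: nth_elliptic.
- by move=> p x y pV; apply: suppD; exact: nth_elliptic.
- by move=> p x; exact: q_le_f.
- exact: f_attained.
- exact: final_q_step.
- by rewrite /q nth_final0.
- by move=> x; apply/is_max_scaled.
Qed.

Lemma word_action_le (h : 'cV[R]_d -> R) w x :
  (forall i x, h (scaled_action i x) <= h x) -> h ((word_prod Bt w)^T *m x) <= h x.
Proof.
move=> hT; elim/last_ind: w x => [|w i IH] x; first by rewrite trmx1 mul1mx.
by rewrite word_prod_rcons trmx_mul -mulmxA (le_trans (IH _)) // hT.
Qed.

End FinalBody.

(** * Explicit formulas for the real and the non-real case *)

Section Cases.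
Variables (R : realType) (d m : nat).
Implicit Types (V : seq (set 'cV[R]_d)) (a b x y z : 'cV[R]_d).

Lemma seq_preimage (T : eqType) (U : Type) (h : U -> T) (t : seq T) :
  (forall X, X \in t -> exists u, X = h u) -> exists F, t = map h F.
Proof.
elim: t => [_|X t IH tP]; first by exists [::].
have [|F ->] := IH; first by move=> Y Yt; apply: tP; rewrite inE Yt orbT.
by have [u ->] := tP X (mem_head _ _); exists (u :: F).
Qed.

Lemma body_pairs (F : seq 'cV[R]_d) :
  body [seq [set v; - v] | v <- F] = convex_hull [set` F ++ map -%R F].
Proof.
congr convex_hull; rewrite -bigcup_seq; apply/seteqP; split.
  move=> u [_ /mapP[v vF ->]] [->|->] /=; rewrite mem_cat ?vF //.
  by rewrite (map_f -%R vF) orbT.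
move=> u /=; rewrite mem_cat => /orP[uF|/mapP[v vF ->]].
  by exists [set u; - u]; [exact: map_f|left].
by exists [set v; - v]; [exact: (map_f (fun v => [set v; - v]))|right].
Qed.

Lemma maxsuppN V x : all_elliptic V -> maxsupp V (- x) = maxsupp V x.
Proof. by move=> ell; rewrite -scaleN1r maxsuppZ // normrN1 mul1r. Qed.

Lemma norm_dotp_body_le V u x : all_elliptic V -> body V u ->
  `|dotp u x| <= maxsupp V x.
Proof.
move=> ell Vu; rewrite ler_norml lerNl body_dotp_le // andbT.
by rewrite -dotpNr -(maxsuppN x ell) body_dotp_le.
Qed.

(** A linear form attains its maximum over the body at a vertex, and the symmetry of the body allows
    the absolute value. *)
Lemma maxsupp_pairs (F : seq 'cV[R]_d) : F <> [::] ->
  let V := [seq [set v; - v] | v <- F] in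
  (forall x, is_max [set `|dotp v x| | v in vertices (body V)] (maxsupp V x)) /\
  piecewise_linear (maxsupp V).
Proof.
move=> F0 V; have ell : all_elliptic V.
  by move=> X /mapP[v _ ->]; exact: elliptic_pair.
have V0 : V <> [::] by case: (F) F0 @V ell.
have att x : exists2 u, u \in F ++ map -%R F & dotp u x = maxsupp V x.
  have [X XV <-] := maxsupp_attained x V0 ell.
  have [u + <-] := supp_attained x (ell X XV).
  move: XV => /mapP[v vF ->] [->|->]; first by exists v; rewrite // mem_cat vF.
  by exists (- v); rewrite // mem_cat (map_f -%R vF) orbT.
have le u x : u \in F ++ map -%R F -> dotp u x <= maxsupp V x.
  by move=> uF; apply: body_dotp_le ell _; rewrite body_pairs; exact: sub_convex_hull.
split; last exact: piecewise_linear_max att le.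
move=> x; split; last first.
  by move=> _ [v [bv _] <-]; exact: norm_dotp_body_le.
have [|v [vF v_vertex] v_max] := vertex_argmax x (F := F ++ map -%R F).
  by case: (F) F0.
exists v; first by rewrite body_pairs.
have vE : dotp v x = maxsupp V x.
  by have [u uF uE] := att x; apply/eqP; rewrite eq_le le // -uE v_max.
by rewrite vE ger0_norm // maxsupp_ge0.
Qed.

Lemma maxsupp_ellipses (N : nat) (a b : 'I_N -> 'cV[R]_d) :
  let V := [seq Phi (a i) (b i) (@unit_circle R) | i <- enum 'I_N] in
  V <> [::] ->
  (forall x, is_max (range (fun i =>
     Num.sqrt (dotp (a i) x ^+ 2 + dotp (b i) x ^+ 2))) (maxsupp V x)) /\
  piecewise_quadratic (maxsupp V).
Proof.
move=> V V0; have ell : all_elliptic V.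
  by move=> X /mapP[i _ ->]; exact: elliptic_Phi.
have ellV i : Phi (a i) (b i) (@unit_circle R) \in V.
  by apply: (map_f (fun i => Phi (a i) (b i) (@unit_circle R))); rewrite mem_enum.
have le i x : Num.sqrt (dotp (a i) x ^+ 2 + dotp (b i) x ^+ 2) <= maxsupp V x.
  by rewrite -supp_Phi supp_le_max.
have att x : exists i, Num.sqrt (dotp (a i) x ^+ 2 + dotp (b i) x ^+ 2) = maxsupp V x.
  have [_ /mapP[i _ ->] <-] := maxsupp_attained x V0 ell.
  by exists i; rewrite supp_Phi.
split.
  by move=> x; split; [have [i iE] := att x; exists i|move=> _ [i _ <-]].
apply: (@piecewise_quadratic_max _ _ [seq (a i, b i) | i <- enum 'I_N]).
  move=> x; have [i iE] := att x; exists (a i, b i) => //.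
  by apply: (map_f (fun i => (a i, b i))); rewrite mem_enum.
by move=> p x /mapP[i _ ->]; exact: le.
Qed.

Lemma body_ellipses (N : nat) (a b : 'I_N -> 'cV[R]_d) :
  body [seq Phi (a i) (b i) (@unit_circle R) | i <- enum 'I_N] =
  convex_hull (\bigcup_i Phi (a i) (b i) (@unit_circle R)).
Proof.
congr convex_hull; rewrite -bigcup_seq; apply/seteqP; split.
  by move=> u [_ /mapP[i _ ->] iu]; exists i.
move=> u [i _ iu]; exists (Phi (a i) (b i) (@unit_circle R)) => //=.
by apply: (map_f (fun i => Phi (a i) (b i) (@unit_circle R))); rewrite mem_enum.
Qed.

Lemma map_ellipses (ab : seq ('cV[R]_d * 'cV[R]_d)) :
  [seq Phi p.1 p.2 (@unit_circle R) | p <- ab] =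
  [seq Phi (tnth (in_tuple ab) i).1 (tnth (in_tuple ab) i).2 (@unit_circle R)
     | i <- enum 'I_(size ab)].
Proof.
have abE : ab = [seq tnth (in_tuple ab) i | i <- enum 'I_(size ab)].
  by rewrite map_tnth_enum.
by rewrite {1}abE -map_comp.
Qed.

(** The transposed product turns the pair [(dotp a z, dotp b z)] by the angle [phi], so its orbit
    comes close to the pair of [y]. *)
Lemma rotation_match (P : 'M[R]_d) a b (phi : R) y z e :
  P *m a = cos phi *: a - sin phi *: b -> P *m b = sin phi *: a + cos phi *: b ->
  irrational (phi / pi) ->
  dotp a y ^+ 2 + dotp b y ^+ 2 = 1 -> dotp a z ^+ 2 + dotp b z ^+ 2 = 1 -> 0 < e ->
  exists k, Num.sqrt (dotp a (y - iter k (mulmx P^T) z) ^+ 2 +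
                      dotp b (y - iter k (mulmx P^T) z) ^+ 2) <= e.
Proof.
move=> Pa Pb phi_irr /unit_circle_angle[al [ya yb]] /unit_circle_angle[be [za zb]] e_gt0.
(* The squared chord between unit vectors at angle [t] is [2 - 2 cos t], below [e^2] once
   [cos t > 1 - e^2 / 2]. *)
have e2_gt0 : 0 < e ^+ 2 / 2 by rewrite divr_gt0 // exprn_gt0.
have [k kP] := irrational_rotation_cos (al - be) phi_irr e2_gt0.
have [az bz] : dotp a (iter k (mulmx P^T) z) = cos (be + k%:R * phi) /\
    dotp b (iter k (mulmx P^T) z) = sin (be + k%:R * phi).
  elim: (k) => [|n [IHa IHb]]; first by rewrite mul0r addr0.
  rewrite iterS -!dotp_mulmx Pa Pb !(dotpDl, dotpNl, dotpZl) IHa IHb.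
  by rewrite -natr1 mulrDl mul1r addrA (cosD _ phi) (sinD _ phi); split; ring.
exists k; rewrite -[leRHS]ger0_norm ?(ltW e_gt0) // -sqrtr_sqr ler_wsqrtr //.
rewrite !dotpDr !dotpNr ya yb az bz.
rewrite -addrA -opprD cosB in kP.
have := cos2Dsin2 al; have := cos2Dsin2 (be + k%:R * phi).
rewrite !sqrrB; nra.
Qed.

End Cases.

Unset Implicit Arguments.

Theorem theorem4 (R : realType) (d m : nat) (hm : (0 < m)%N)
    (A : 'I_m -> 'M[R]_d) (s : seq 'I_m)
    (lambda : complex R) (V1 : set 'cV[R]_d)
    (k : nat) (V : seq (set 'cV[R]_d)) :
  let B := transpose_family A in
  let Bt := normalized B s in
  irreducible_family A ->
  primitive_word s ->
  0 < nu B s ->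
  leading_eigenvalue (word_prod B s) lambda ->
  starting_set (word_prod Bt s) (real_complex R (nu B s ^- size s) * lambda) V1 ->
  terminates_after Bt s V1 k V ->
  (complex.Im lambda = 0 ->
     exists f : 'cV[R]_d -> R,
       [/\ forall x, is_max [set `|dotp v x| | v in vertices (body V)] (f x),
           piecewise_linear f,
           barabanov A f &
           unique_barabanov A f]) /\
  (complex.Im lambda != 0 ->
     (exists (N : nat) (a b : 'I_N -> 'cV[R]_d),
        V = [seq Phi (a i) (b i) (@unit_circle R) | i <- enum 'I_N]) /\
     (forall (N : nat) (a b : 'I_N -> 'cV[R]_d),
        V = [seq Phi (a i) (b i) (@unit_circle R) | i <- enum 'I_N] ->
        body V = convex_hull (\bigcup_i Phi (a i) (b i) (@unit_circle R)) /\
        exists f : 'cV[R]_d -> R,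
          [/\ forall x, is_max (range (fun i =>
                Num.sqrt (dotp (a i) x ^+ 2 + dotp (b i) x ^+ 2))) (f x),
              piecewise_quadratic f,
              barabanov A f &
              irrational_arg lambda -> unique_barabanov A f])).

Proof.
move=> B Bt A_irr s_prim nu_gt0 leading start [k_gt0 run].
have s_neq0 : s <> [::] by case: s_prim.
have d_gt0 : (0 < d)%N by case: leading => /eigenvalue_dim_gt0.
have l1 := normc_normalized s_neq0 nu_gt0 leading.
have final := algorithm_tree_state run.
have nun_gt0 : 0 < nu B s ^- size s by rewrite invr_gt0 exprn_gt0.
have V_neq0 : V <> [::].
  move=> V0; have [_ [_ [W VE] _ _]] := final.
  by move: VE; rewrite V0; case: (s) s_neq0.
have lE := normalized_eigenvalueE B s lambda.
split=> [Im0|Im_neq0].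
  have [|v [V1E v0 cycle]] := starting_set_real start l1.
    by rewrite lE /= Im0 mulr0.
  have ell : elliptic V1 by rewrite V1E; exact: elliptic_pair.
  have V1n0 : exists2 v, V1 v & v != 0 by exists v; rewrite // V1E; left.
  have [F VE] : exists F, V = [seq [set v; - v] | v <- F].
    apply: seq_preimage; apply: (final_ind (K := fun X => exists v, X = [set v; - v]) final).
      by exists v.
    by move=> M _ [u ->]; exists (M *m u); rewrite apply_pair.
  have F0 : F <> [::] by move=> F0; apply: V_neq0; rewrite VE F0.
  have [f_max f_lin] := maxsupp_pairs F0; rewrite -VE in f_max f_lin.
  exists (maxsupp V); split=> //.
    exact: final_barabanov d_gt0 A_irr s_prim nu_gt0 final cycle ell V1n0.
  apply: (final_unique d_gt0 A_irr s_prim nu_gt0 final cycle ell V1n0).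
  move=> y z e; rewrite V1E !supp_pair => vy vz e_gt0.
  have {vy} vy2 : dotp v y ^+ 2 = 1 by rewrite -real_normK ?num_real // vy expr1n.
  have {vz} vz2 : dotp v z ^+ 2 = 1 by rewrite -real_normK ?num_real // vz expr1n.
  (* The scalar is 1 or -1, and gives the new point the same product with [v] as [y] has. *)
  exists ((dotp v y * dotp v z) *: z).
    rewrite supp_pair dotpDr dotpNr dotpZr -mulrA -expr2 vz2 mulr1 subrr normr0.
    exact: ltW.
  move=> h [_ _ hZ _] _; rewrite hZ.
  have : (dotp v y * dotp v z) ^+ 2 = 1 by rewrite exprMn vy2 vz2 mulr1.
  by move=> /eqP; rewrite sqrf_eq1 => /orP[]/eqP ->; rewrite ?normrN1 ?normr1 mul1r.
have [|a [b [V1E ab0 Pa Pb cycle]]] := starting_set_nonreal start l1.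
  by rewrite lE /= mulf_neq0 // gt_eqF.
have ell : elliptic V1 by rewrite V1E; exact: elliptic_Phi.
have V1n0 : exists2 v, V1 v & v != 0.
  rewrite V1E; case/orP: ab0 => [a0|b0].
    exists a => //; exists (1, 0); rewrite /= ?scale1r ?scale0r ?addr0 //.
    by rewrite /unit_circle /= expr1n expr0n addr0.
  exists b => //; exists (0, 1); rewrite /= ?scale1r ?scale0r ?add0r //.
  by rewrite /unit_circle /= expr1n expr0n add0r.
split.
  have [F ->] : exists F, V = [seq Phi p.1 p.2 (@unit_circle R) | p <- F].
    apply: seq_preimage; apply: (final_ind (K := fun X => exists p, X = Phi p.1 p.2 (@unit_circle R))
      final); first by exists (a, b).
    by move=> M _ [p ->]; exists (M *m p.1, M *m p.2); rewrite apply_Phi.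
  by rewrite map_ellipses; eexists _, _, _.
move=> N a' b' VE; split; first by rewrite VE body_ellipses.
have [|f_max f_quad] := @maxsupp_ellipses _ _ _ a' b'; first by rewrite -VE.
rewrite -VE in f_max f_quad.
exists (maxsupp V); split=> //.
  exact: final_barabanov d_gt0 A_irr s_prim nu_gt0 final cycle ell V1n0.
move=> [phi lambdaE phi_irr].
apply: (final_unique d_gt0 A_irr s_prim nu_gt0 final cycle ell V1n0).
have nc : nu B s ^- size s * Normc.normc lambda = 1.
  by rewrite (normc_leading s_neq0 leading) mulVf // gt_eqF // exprn_gt0.
have ReE : complex.Re (real_complex R (nu B s ^- size s) * lambda) = cos phi.
  by rewrite lE /= [X in complex.Re X]lambdaE /= mulrA nc mul1r.
have ImE : complex.Im (real_complex R (nu B s ^- size s) * lambda) = sin phi.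
  by rewrite lE /= [X in complex.Im X]lambdaE /= mulrA nc mul1r.
rewrite ReE ImE in Pa Pb.
move=> y z e; rewrite V1E !supp_Phi => vy vz e_gt0.
have sqr1 (r : R) : 0 <= r -> Num.sqrt r = 1 -> r = 1.
  by move=> r0 r1; rewrite -(sqr_sqrtr r0) r1 expr1n.
have sq2_ge0 w : 0 <= dotp a w ^+ 2 + dotp b w ^+ 2 by rewrite addr_ge0 ?sqr_ge0.
have [j jP] := rotation_match Pa Pb phi_irr (sqr1 _ (sq2_ge0 y) vy) (sqr1 _ (sq2_ge0 z) vz) e_gt0.
(* Each iterate applies a whole word of scaled actions, so [h] cannot increase. *)
exists (iter j (mulmx (word_prod Bt s)^T) z); first by rewrite supp_Phi.
move=> h _ hT; elim: j {jP} => [//|j IH].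
exact: le_trans (word_action_le _ _ hT) IH.
Qed.
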